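(* Let $F=L-N:X\to Y$ satisfy hypothesis (H). Then for each $t\in\mathbb{R}$ the map $PF_t: H_X\to H_Y$, $PF_t(w)=P F(w+t\phi_p)$, is a bi-Lipschitz homeomorphism, and the Lipschitz constants of $PF_t$ and of $(PF_t)^{-1}$ can be chosen independent of $t$. Moreover, if $F$ is of class $C^k$ ($k\ge 1$), then each $PF_t$ is a $C^k$ diffeomorphism.
   Context: Let $X,Y$ be real Hilbert spaces, $X$ densely included in $Y$, and let $L:X\subset Y\to Y$ be a self-adjoint operator, $X$ carrying the graph norm $\|x\|_X=\|x\|_Y+\|Lx\|_Y$. Let $\lambda_p$ be a simple isolated eigenvalue of $L$ with eigenvector $\phi_p\in X$, $\|\phi_p\|_Y=1$. Let $V_X=V_Y=\langle\phi_p\rangle$ be its real span, $H_Y=\{y\in Y:\langle y,\phi_p\rangle_Y=0\}$, $H_X=X\cap H_Y$, so $X=H_X\oplus V_X$, $Y=H_Y\oplus V_Y$, and let $P:Y\to H_Y$ be the orthogonal projection. Let $N:Y\to Y$ and $F=L-N:X\to Y$. For $t\in\mathbb{R}$ define $PN_t:H_Y\to H_Y$, $PN_t(w)=PN(w+t\phi_p)$. Hypothesis (H): there is $n\ge 0$ such that every $PN_t$, $t\in\mathbb{R}$, is Lipschitz with constant $n$ (independent of $t$), and $[-n,n]\cap\sigma(L)=\{\lambda_p\}$. *)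

(* Defs.v *)
From Stdlib Require Import Reals.
Open Scope R_scope.

Record RHilbert := {
  hcar :> Type;
  vadd : hcar -> hcar -> hcar;
  vscal : R -> hcar -> hcar;
  vzero : hcar;
  inner : hcar -> hcar -> R;
  vadd_assoc : forall x y z, vadd x (vadd y z) = vadd (vadd x y) z;
  vadd_comm : forall x y, vadd x y = vadd y x;
  vadd_0 : forall x, vadd vzero x = x;
  vadd_opp : forall x, vadd x (vscal (-1) x) = vzero;
  vscal_1 : forall x, vscal 1 x = x;
  vscal_assoc : forall a b x, vscal a (vscal b x) = vscal (a * b) x;
  vscal_distr_v : forall a x y, vscal a (vadd x y) = vadd (vscal a x) (vscal a y);
  vscal_distr_s : forall a b x, vscal (a + b) x = vadd (vscal a x) (vscal b x);
  inner_sym : forall x y, inner x y = inner y x;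
  inner_add : forall x y z, inner (vadd x y) z = inner x z + inner y z;
  inner_scal : forall a x y, inner (vscal a x) y = a * inner x y;
  inner_pos : forall x, 0 <= inner x x;
  inner_def : forall x, inner x x = 0 -> x = vzero;
  hcomplete : forall u : nat -> hcar,
    (forall eps, 0 < eps -> exists N, forall m k, (N <= m)%nat -> (N <= k)%nat ->
        sqrt (inner (vadd (u m) (vscal (-1) (u k))) (vadd (u m) (vscal (-1) (u k)))) < eps) ->
    exists l, forall eps, 0 < eps -> exists N, forall m, (N <= m)%nat ->
        sqrt (inner (vadd (u m) (vscal (-1) l)) (vadd (u m) (vscal (-1) l))) < eps
}.

Arguments vadd {_}. Arguments vscal {_}. Arguments vzero {_}. Arguments inner {_}.

Definition vsub {Y : RHilbert} (x y : Y) : Y := vadd x (vscal (-1) y).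
Definition hnorm {Y : RHilbert} (x : Y) : R := sqrt (inner x x).

(* ---------- Densely defined self-adjoint operators ----------
   An operator L : X subset Y -> Y is encoded by its domain D (a predicate on Y)
   and a total function L : Y -> Y whose values outside D are irrelevant. *)
Definition subspace {Y : RHilbert} (D : Y -> Prop) : Prop :=
  D vzero /\ (forall x y, D x -> D y -> D (vadd x y)) /\
  (forall a x, D x -> D (vscal a x)).

Definition dense {Y : RHilbert} (D : Y -> Prop) : Prop :=
  forall y eps, 0 < eps -> exists x, D x /\ hnorm (vsub x y) < eps.

Definition linear_on {Y : RHilbert} (D : Y -> Prop) (L : Y -> Y) : Prop :=
  (forall x y, D x -> D y -> L (vadd x y) = vadd (L x) (L y)) /\
  (forall a x, D x -> L (vscal a x) = vscal a (L x)).

(* L is self-adjoint: densely defined, symmetric, and D(L^* ) is contained in D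
   with L^* = L there (so L = L^* ). *)
Definition self_adjoint {Y : RHilbert} (D : Y -> Prop) (L : Y -> Y) : Prop :=
  subspace D /\ dense D /\ linear_on D L /\
  (forall x y, D x -> D y -> inner (L x) y = inner x (L y)) /\
  (forall y z, (forall x, D x -> inner (L x) y = inner x z) -> D y /\ L y = z).

Definition in_resolvent {Y : RHilbert} (D : Y -> Prop) (L : Y -> Y) (mu : R) : Prop :=
  exists Rm : Y -> Y,
    (forall y, D (Rm y) /\ vsub (L (Rm y)) (vscal mu (Rm y)) = y) /\
    (forall x, D x -> Rm (vsub (L x) (vscal mu x)) = x) /\
    (exists C, forall y, hnorm (Rm y) <= C * hnorm y).

Definition in_spectrum {Y : RHilbert} (D : Y -> Prop) (L : Y -> Y) (mu : R) : Prop :=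
  ~ in_resolvent D L mu.

Definition simple_isolated_eigen {Y : RHilbert} (D : Y -> Prop) (L : Y -> Y)
    (lam : R) (phi : Y) : Prop :=
  D phi /\ L phi = vscal lam phi /\ hnorm phi = 1 /\
  (forall x, D x -> L x = vscal lam x -> exists c, x = vscal c phi) /\
  (exists eps, 0 < eps /\
     forall mu, Rabs (mu - lam) < eps -> in_spectrum D L mu -> mu = lam).

Definition graph_norm {Y : RHilbert} (L : Y -> Y) (x : Y) : R :=
  hnorm x + hnorm (L x).

Definition HY {Y : RHilbert} (phi : Y) (y : Y) : Prop := inner y phi = 0.
Definition HX {Y : RHilbert} (D : Y -> Prop) (phi : Y) (y : Y) : Prop :=
  D y /\ inner y phi = 0.
Definition Pproj {Y : RHilbert} (phi : Y) (y : Y) : Y :=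
  vsub y (vscal (inner y phi) phi).

Definition PF {Y : RHilbert} (L N : Y -> Y) (phi : Y) (t : R) (w : Y) : Y :=
  Pproj phi (vsub (L (vadd w (vscal t phi))) (N (vadd w (vscal t phi)))).

Definition bilip_homeo_with {Y : RHilbert} (S T : Y -> Prop) (nS nT : Y -> R)
    (f g : Y -> Y) (c1 c2 : R) : Prop :=
  (forall x, S x -> T (f x)) /\ (forall y, T y -> S (g y)) /\
  (forall x, S x -> g (f x) = x) /\ (forall y, T y -> f (g y) = y) /\
  (forall x1 x2, S x1 -> S x2 -> nT (vsub (f x1) (f x2)) <= c1 * nS (vsub x1 x2)) /\
  (forall y1 y2, T y1 -> T y2 -> nS (vsub (g y1) (g y2)) <= c2 * nT (vsub y1 y2)).

(* ---------- C^k maps (Frechet sense) between normed linear subspaces ----------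
   f : (S, nS) -> (Y, nT), S a linear subspace.  f is C^k iff there are
   Dk j x : (nat -> Y) -> Y  (j = 0..k), the j-th Frechet derivative at x,
   a bounded j-linear map of its first j arguments, with D 0 x = f x,
   D (j+1) the Frechet derivative of x |-> D j x in the (multilinear) operator
   norm, and x |-> D j x continuous in that operator norm. *)
Fixpoint prodn {Y : RHilbert} (nS : Y -> R) (h : nat -> Y) (j : nat) : R :=
  match j with O => 1 | Datatypes.S j' => prodn nS h j' * nS (h j') end.

Definition upd {Y : RHilbert} (h : nat -> Y) (i : nat) (v : Y) : nat -> Y :=
  fun k => if Nat.eqb k i then v else h k.

Definition hcons {Y : RHilbert} (v : Y) (h : nat -> Y) : nat -> Y :=
  fun k => match k with O => v | Datatypes.S k' => h k' end.

Definition args_in {Y : RHilbert} (S : Y -> Prop) (h : nat -> Y) (j : nat) : Prop :=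
  forall i, (i < j)%nat -> S (h i).

Definition bounded_multilinear {Y : RHilbert} (S : Y -> Prop) (nS nT : Y -> R)
    (j : nat) (M : (nat -> Y) -> Y) : Prop :=
  (forall h h', (forall i, (i < j)%nat -> h i = h' i) -> M h = M h') /\
  (forall h i a u v, (i < j)%nat -> args_in S h j -> S u -> S v ->
     M (upd h i (vadd (vscal a u) v)) = vadd (vscal a (M (upd h i u))) (M (upd h i v))) /\
  (exists C, forall h, args_in S h j -> nT (M h) <= C * prodn nS h j).

Definition Ck {Y : RHilbert} (S : Y -> Prop) (nS nT : Y -> R) (f : Y -> Y)
    (k : nat) : Prop :=
  exists Dk : nat -> Y -> (nat -> Y) -> Y,
    (forall x h, S x -> Dk O x h = f x) /\
    (forall j x, (j <= k)%nat -> S x -> bounded_multilinear S nS nT j (Dk j x)) /\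
    (forall j x, (j < k)%nat -> S x ->
       forall eps, 0 < eps -> exists delta, 0 < delta /\
         forall v, S v -> nS v < delta -> forall h, args_in S h j ->
           nT (vsub (vsub (Dk j (vadd x v) h) (Dk j x h)) (Dk (Datatypes.S j) x (hcons v h)))
             <= eps * nS v * prodn nS h j) /\
    (forall j x, (j <= k)%nat -> S x ->
       forall eps, 0 < eps -> exists delta, 0 < delta /\
         forall y, S y -> nS (vsub y x) < delta -> forall h, args_in S h j ->
           nT (vsub (Dk j y h) (Dk j x h)) <= eps * prodn nS h j).

Definition Ck_diffeo {Y : RHilbert} (S T : Y -> Prop) (nS nT : Y -> R)
    (f : Y -> Y) (k : nat) : Prop :=
  (forall x, S x -> T (f x)) /\
  exists g : Y -> Y, (forall y, T y -> S (g y)) /\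
    (forall x, S x -> g (f x) = x) /\ (forall y, T y -> f (g y) = y) /\
    Ck S nS nT f k /\ Ck T nT nS g k.

(* Main.v *)
Require Import Defs.
From Stdlib Require Import Reals Lra Lia Psatz List Classical ClassicalEpsilon.
From Stdlib Require Import FunctionalExtensionality ProofIrrelevance.
Import ListNotations.
Open Scope R_scope.

(** [L] maps [H_X] to [H_Y] and is symmetric there.  Every [mu] in [[-n, n]] is regular for
    this restriction: for [mu <> lam_p] it lies in the resolvent set of [L], and [lam_p]
    itself becomes regular because an isolated spectral value of the restriction would be an
    eigenvalue, which simplicity excludes.  As the best constant in
    [|L w| >= m |w|] is attained at a spectral value [m] or [-m], this gives [m > n], and the
    equation [L w - PN_t w = z] is solved by iterating [w |-> L^-1 (z + PN_t w)], a
    contraction of ratio [n / m], with constants independent of [t].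

    For the smooth part, the derivative of [PF_t] at a point has the form [L - G] with [G]
    linear of norm at most [n], so the same argument inverts it with a uniform bound.  The
    inverse function theorem is then the bootstrap [g' = (f' o g)^-1] in spaces of bounded
    operators, and iterated operators are the same thing as bounded multilinear maps. *)

(** * Seminormed spaces and Hilbert spaces *)

(** Regularity of [lam_p] on [H_X] is derived from resolvent bounds alone. Put [M = L - lam_p].
    Symmetry and isolation give [|M x - nu x| >= |nu| |x|] for small [nu <> 0], and polarising this
    bounds [M] below on vectors of its own range. If [M a - nu a = y] and [nu] tends to 0, the error
    [- nu a] converges to a kernel vector, hence to 0. So the range is dense, the lower bound
    extends to the whole domain, and closedness gives surjectivity.

    That the best constant [m] is spectral comes from [M^2 - m^2 = (M - m) (M + m)]: were both
    factors bounded below, [m] could be enlarged.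

    In the smooth part, derivatives are taken in the graph norm, whereas [n] is measured in the norm
    of [Y]. The difference quotients of [PN_t] nevertheless bound [L - (PF_t)'] by [n] in the norm
    of [Y], so one perturbation lemma inverts both [PF_t] and all its derivatives, with one
    constant. The inverse function theorem thus starts from a global Lipschitz inverse, and only the
    smoothness of that inverse remains to be proved. *)

Record SNSpace := {
  ncar :> Type;
  add : ncar -> ncar -> ncar;
  scal : R -> ncar -> ncar;
  zero : ncar;
  norm : ncar -> R;
  add_assoc : forall x y z, add x (add y z) = add (add x y) z;
  add_comm : forall x y, add x y = add y x;
  add_0 : forall x, add zero x = x;
  add_opp : forall x, add x (scal (-1) x) = zero;
  scal_1 : forall x, scal 1 x = x;
  scal_assoc : forall a b x, scal a (scal b x) = scal (a * b) x;
  scal_distr_v : forall a x y, scal a (add x y) = add (scal a x) (scal a y);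
  scal_distr_s : forall a b x, scal (a + b) x = add (scal a x) (scal b x);
  norm_pos : forall x, 0 <= norm x;
  norm_triang : forall x y, norm (add x y) <= norm x + norm y;
  norm_scal : forall a x, norm (scal a x) <= Rabs a * norm x
}.

Arguments add {_}. Arguments scal {_}. Arguments zero {_}. Arguments norm {_}.

Definition sub {X : SNSpace} (x y : X) : X := add x (scal (-1) y).

(** * Vector identities, decided by comparing coefficients *)

Section LinearCombinations.
Variable X : SNSpace.

Lemma scal_0 (x : X) : scal 0 x = zero.
Proof.
  replace 0 with (1 + -1) by ring.
  rewrite scal_distr_s, scal_1; apply add_opp.
Qed.

Lemma scal_zero (a : R) : scal a (zero : X) = zero.
Proof. rewrite <- (scal_0 zero), scal_assoc, Rmult_0_r; reflexivity. Qed.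

(** Syntax for proof by reflection: a vector identity follows from one real equation per atom, which
    [ring] can settle. *)
Inductive vexp := VAtom (i : nat) | VZero | VAdd (a b : vexp) | VScal (r : R) (a : vexp).

Fixpoint veval (env : list X) (e : vexp) : X :=
  match e with
  | VAtom i => nth i env zero
  | VZero => zero
  | VAdd a b => add (veval env a) (veval env b)
  | VScal r a => scal r (veval env a)
  end.

Fixpoint vcoef (e : vexp) (i : nat) : R :=
  match e with
  | VAtom j => if Nat.eqb i j then 1 else 0
  | VZero => 0
  | VAdd a b => vcoef a i + vcoef b i
  | VScal r a => r * vcoef a i
  end.

Fixpoint lincomb (c : nat -> R) (env : list X) : X :=
  match env with
  | [] => zero
  | x :: l => add (scal (c O) x) (lincomb (fun i => c (S i)) l)
  end.

Lemma add_swap (a b c d : X) : add (add a b) (add c d) = add (add a c) (add b d).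
Proof.
  rewrite <- !add_assoc, (add_assoc _ b c d), (add_comm _ b c), <- add_assoc.
  reflexivity.
Qed.

Lemma lincomb_add c d env :
  lincomb (fun i => c i + d i) env = add (lincomb c env) (lincomb d env).
Proof.
  revert c d; induction env as [|x l IH]; intros c d; cbn.
  - symmetry; apply add_0.
  - rewrite (IH (fun i => c (S i))), scal_distr_s; apply add_swap.
Qed.

Lemma lincomb_scal r c env :
  lincomb (fun i => r * c i) env = scal r (lincomb c env).
Proof.
  revert c; induction env as [|x l IH]; intros c; cbn.
  - symmetry; apply scal_zero.
  - rewrite (IH (fun i => c (S i))), scal_distr_v, scal_assoc; reflexivity.
Qed.

Lemma lincomb_0 env : lincomb (fun _ => 0) env = zero.
Proof.
  induction env as [|x l IH]; cbn; [reflexivity|].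
  rewrite IH, scal_0; apply add_0.
Qed.

Lemma lincomb_atom j env :
  lincomb (fun i => if Nat.eqb i j then 1 else 0) env = nth j env zero.
Proof.
  revert j; induction env as [|x l IH]; intros [|j]; cbn; try reflexivity.
  - rewrite lincomb_0, scal_1, add_comm; apply add_0.
  - rewrite IH, scal_0; apply add_0.
Qed.

Lemma veval_lincomb env e : veval env e = lincomb (vcoef e) env.
Proof.
  induction e as [i| |a IHa b IHb|r a IHa]; cbn.
  - symmetry; apply lincomb_atom.
  - symmetry; apply lincomb_0.
  - rewrite IHa, IHb; symmetry; apply lincomb_add.
  - rewrite IHa; symmetry; apply lincomb_scal.
Qed.

Fixpoint same_coefs (n : nat) (e1 e2 : vexp) : Prop :=
  match n with
  | O => True
  | S m => vcoef e1 m = vcoef e2 m /\ same_coefs m e1 e2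
  end.

Lemma same_coefs_lt n e1 e2 i :
  same_coefs n e1 e2 -> (i < n)%nat -> vcoef e1 i = vcoef e2 i.
Proof.
  induction n as [|n IH]; cbn; [lia|].
  intros [H1 H2] Hi; destruct (Nat.eq_dec i n) as [->|Hne]; [exact H1|].
  apply IH; [exact H2|lia].
Qed.

Lemma lincomb_ext c d env :
  (forall i, (i < length env)%nat -> c i = d i) -> lincomb c env = lincomb d env.
Proof.
  revert c d; induction env as [|x l IH]; intros c d H; cbn; [reflexivity|].
  rewrite (H O) by (cbn; lia).
  f_equal; apply IH; intros i Hi; apply H; cbn; lia.
Qed.

Lemma veval_eq env e1 e2 :
  same_coefs (length env) e1 e2 -> veval env e1 = veval env e2.
Proof.
  intros H; rewrite !veval_lincomb; apply lincomb_ext.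
  intros i Hi; exact (same_coefs_lt _ _ _ _ H Hi).
Qed.

End LinearCombinations.

Ltac vec_mem x l :=
  lazymatch l with
  | [] => constr:(false)
  | x :: _ => constr:(true)
  | _ :: ?t => vec_mem x t
  end.

Ltac vec_index x l :=
  lazymatch l with
  | x :: _ => constr:(O)
  | _ :: ?t => let i := vec_index x t in constr:(S i)
  end.

Ltac vec_atoms l e :=
  lazymatch e with
  | vadd ?a ?b => let l1 := vec_atoms l a in vec_atoms l1 b
  | add ?a ?b => let l1 := vec_atoms l a in vec_atoms l1 b
  | vsub ?a ?b => let l1 := vec_atoms l a in vec_atoms l1 b
  | sub ?a ?b => let l1 := vec_atoms l a in vec_atoms l1 b
  | vscal _ ?a => vec_atoms l a
  | scal _ ?a => vec_atoms l a
  | vzero => l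
  | zero => l
  | ?x => let b := vec_mem x l in
          lazymatch b with true => l | false => constr:(x :: l) end
  end.

Ltac vec_reify l e :=
  lazymatch e with
  | vadd ?a ?b => let p := vec_reify l a in let q := vec_reify l b in constr:(VAdd p q)
  | add ?a ?b => let p := vec_reify l a in let q := vec_reify l b in constr:(VAdd p q)
  | vsub ?a ?b =>
      let p := vec_reify l a in let q := vec_reify l b in constr:(VAdd p (VScal (-1) q))
  | sub ?a ?b =>
      let p := vec_reify l a in let q := vec_reify l b in constr:(VAdd p (VScal (-1) q))
  | vscal ?r ?a => let p := vec_reify l a in constr:(VScal r p)
  | scal ?r ?a => let p := vec_reify l a in constr:(VScal r p)
  | vzero => constr:(VZero)
  | zero => constr:(VZero)
  | ?x => let i := vec_index x l in constr:(VAtom i)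
  end.

(** The operations of a Hilbert space are convertible to those of [hilbert_space Y], so a single
    [change] serves both kinds of space. *)
Ltac vec_in X a b :=
  let l0 := vec_atoms (@nil (ncar X)) a in
  let l := vec_atoms l0 b in
  let e1 := vec_reify l a in
  let e2 := vec_reify l b in
  change (veval X l e1 = veval X l e2);
  apply veval_eq;
  cbv [same_coefs vcoef Nat.eqb length];
  repeat split; try ring.

Ltac nvec :=
  lazymatch goal with
  | |- @eq (ncar ?X) ?a ?b => vec_in X a b
  end.

(** * The norm of a real Hilbert space *)

Section HilbertNorm.
Variable Y : RHilbert.
Implicit Types x y z : Y.

Lemma inner_add_r x y z : inner x (vadd y z) = inner x y + inner x z.
Proof. rewrite inner_sym, inner_add, !(inner_sym _ x); reflexivity. Qed.

Lemma inner_scal_r a x y : inner x (vscal a y) = a * inner x y.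
Proof. rewrite inner_sym, inner_scal, inner_sym; reflexivity. Qed.

Lemma hnorm_pos x : 0 <= hnorm x.
Proof. apply sqrt_pos. Qed.

Lemma hnorm_sq x : hnorm x * hnorm x = inner x x.
Proof. apply sqrt_sqrt, inner_pos. Qed.

Lemma hnorm_scal a x : hnorm (vscal a x) = Rabs a * hnorm x.
Proof.
  unfold hnorm; rewrite inner_scal, inner_scal_r, <- Rmult_assoc.
  rewrite sqrt_mult_alt by nra.
  rewrite <- sqrt_Rsqr_abs; reflexivity.
Qed.

Lemma cauchy_schwarz x y : Rabs (inner x y) <= hnorm x * hnorm y.
Proof.
  apply Rsqr_incr_0_var; [|apply Rmult_le_pos; apply hnorm_pos].
  rewrite <- Rsqr_abs; unfold Rsqr.
  replace (hnorm x * hnorm y * (hnorm x * hnorm y))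
    with (inner x x * inner y y) by (rewrite <- !hnorm_sq; ring).
  (* The squared norm of [<y,y> x - <x,y> y] equals [<y,y> (<x,x> <y,y> - <x,y>^2)]; the factor
     [<y,y>] is cancelled below. *)
  pose proof (inner_pos _ (vadd (vscal (inner y y) x) (vscal (- inner x y) y))) as H.
  rewrite inner_add, !inner_scal, !inner_add_r, !inner_scal_r, (inner_sym _ y x) in H.
  pose proof (inner_pos _ y) as Hy.
  destruct (Req_dec (inner y y) 0) as [E|E].
  - apply inner_def in E; subst y.
    pose proof (inner_add _ vzero vzero x) as E; rewrite vadd_0 in E.
    rewrite (inner_sym _ x vzero); replace (inner vzero x) with 0 by lra.
    pose proof (Rmult_le_pos _ _ (inner_pos _ x) (inner_pos _ (vzero : Y))); lra.
  - apply Rmult_le_reg_l with (inner y y); nra.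
Qed.

Lemma hnorm_triang x y : hnorm (vadd x y) <= hnorm x + hnorm y.
Proof.
  pose proof (hnorm_pos x); pose proof (hnorm_pos y).
  apply Rsqr_incr_0_var; [|lra]; unfold Rsqr.
  rewrite hnorm_sq, inner_add, !inner_add_r, (inner_sym _ y x), <- !hnorm_sq.
  pose proof (cauchy_schwarz x y); pose proof (Rle_abs (inner x y)); nra.
Qed.

Definition hilbert_space : SNSpace :=
  Build_SNSpace Y vadd vscal vzero hnorm (vadd_assoc Y) (vadd_comm Y) (vadd_0 Y)
    (vadd_opp Y) (vscal_1 Y) (vscal_assoc Y) (vscal_distr_v Y) (vscal_distr_s Y)
    hnorm_pos hnorm_triang (fun a x => Req_le _ _ (hnorm_scal a x)).

End HilbertNorm.

Ltac hvec :=
  lazymatch goal with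
  | |- @eq (hcar ?Y) ?a ?b => vec_in (hilbert_space Y) a b
  end.

Ltac inner_expand :=
  unfold vsub; rewrite ?inner_add, ?inner_scal, ?inner_add_r, ?inner_scal_r,
    ?inner_add_r, ?inner_scal_r.

Section HilbertSequences.
Variable Y : RHilbert.
Implicit Types x y z : Y.

Lemma vsub_self x : vsub x x = vzero.
Proof. hvec. Qed.

Lemma vsub_zero_eq x y : vsub x y = vzero -> x = y.
Proof.
  intros H; replace x with (vadd (vsub x y) y) by hvec.
  rewrite H; hvec.
Qed.

Lemma inner_vzero_l x : inner vzero x = 0.
Proof.
  replace (vzero : Y) with (vscal 0 (vzero : Y)) by hvec.
  rewrite inner_scal; ring.
Qed.

Lemma hnorm_vzero : hnorm (vzero : Y) = 0.
Proof. unfold hnorm; rewrite inner_vzero_l; apply sqrt_0. Qed.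

Lemma hnorm_le0 x : hnorm x <= 0 -> x = vzero.
Proof.
  intros H; apply inner_def; rewrite <- hnorm_sq.
  pose proof (hnorm_pos _ x); nra.
Qed.

Lemma hnorm_sub_sym x y : hnorm (vsub x y) = hnorm (vsub y x).
Proof.
  replace (vsub x y) with (vscal (-1) (vsub y x)) by hvec.
  rewrite hnorm_scal, Rabs_left by lra; ring.
Qed.

Lemma hnorm_sub_triang x y : hnorm (vsub x y) <= hnorm x + hnorm y.
Proof.
  unfold vsub; eapply Rle_trans; [apply hnorm_triang|].
  rewrite hnorm_scal, Rabs_left by lra; lra.
Qed.

Lemma hnorm_le_sub x y : hnorm x <= hnorm y + hnorm (vsub x y).
Proof.
  replace x with (vadd y (vsub x y)) at 1 by hvec; apply hnorm_triang.
Qed.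

Definition converges (u : nat -> Y) (l : Y) : Prop :=
  forall eps, 0 < eps -> exists K, forall m, (K <= m)%nat -> hnorm (vsub (u m) l) < eps.

Lemma complete_of_bound (u : nat -> Y) (d : nat -> R) :
  (forall m k, hnorm (vsub (u m) (u k)) <= d m + d k) ->
  Un_cv d 0 -> exists l, converges u l.
Proof.
  intros Hu Hd; apply (hcomplete Y u).
  intros eps He; destruct (Hd (eps / 2)) as [K HK]; [lra|].
  exists K; intros m k Hm Hk.
  pose proof (HK m Hm) as H1; pose proof (HK k Hk) as H2.
  unfold Rdist in H1, H2; rewrite Rminus_0_r in H1, H2.
  apply Rabs_def2 in H1; apply Rabs_def2 in H2.
  pose proof (Hu m k) as H; unfold hnorm, vsub in H; lra.
Qed.

Lemma converges_of_bound u l (d : nat -> R) :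
  (forall m, hnorm (vsub (u m) l) <= d m) -> Un_cv d 0 -> converges u l.
Proof.
  intros Hu Hd eps He; destruct (Hd eps He) as [K HK]; exists K; intros m Hm.
  pose proof (HK m Hm) as H1; unfold Rdist in H1; rewrite Rminus_0_r in H1.
  apply Rabs_def2 in H1; specialize (Hu m); lra.
Qed.

Lemma converges_lincomb u v a b x y :
  converges u x -> converges v y ->
  converges (fun k => vadd (vscal a (u k)) (vscal b (v k))) (vadd (vscal a x) (vscal b y)).
Proof.
  intros Hu Hv eps He.
  pose proof (Rabs_pos a) as Ha; pose proof (Rabs_pos b) as Hb.
  assert (Hd : 0 < eps / (Rabs a + Rabs b + 1)) by (apply Rdiv_lt_0_compat; lra).
  destruct (Hu _ Hd) as [K1 H1]; destruct (Hv _ Hd) as [K2 H2].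
  exists (max K1 K2); intros m Hm.
  specialize (H1 m ltac:(lia)); specialize (H2 m ltac:(lia)).
  replace (vsub _ _) with (vadd (vscal a (vsub (u m) x)) (vscal b (vsub (v m) y))) by hvec.
  eapply Rle_lt_trans; [apply hnorm_triang|]; rewrite !hnorm_scal.
  set (d := eps / (Rabs a + Rabs b + 1)) in *.
  assert (E : eps = (Rabs a + Rabs b + 1) * d) by (unfold d; field; lra).
  pose proof (hnorm_pos _ (vsub (u m) x)); pose proof (hnorm_pos _ (vsub (v m) y)); nra.
Qed.

Lemma converges_inner u l z c :
  converges u l -> (forall k, inner (u k) z = c) -> inner l z = c.
Proof.
  intros Hu Hc.
  assert (H : Rabs (inner l z - c) <= 0).
  { apply le_epsilon; intros eps He; pose proof (hnorm_pos _ z) as Hz.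
    destruct (Hu (eps / (hnorm z + 1))) as [K HK]; [apply Rdiv_lt_0_compat; lra|].
    specialize (HK K (le_n K)).
    rewrite <- (Hc K), Rabs_minus_sym.
    replace (inner (u K) z - inner l z) with (inner (vsub (u K) l) z) by (inner_expand; ring).
    eapply Rle_trans; [apply cauchy_schwarz|].
    assert (E : eps = eps / (hnorm z + 1) * (hnorm z + 1)) by (field; lra).
    pose proof (hnorm_pos _ (vsub (u K) l)); nra. }
  pose proof (Rabs_pos (inner l z - c)).
  destruct (Req_dec (inner l z - c) 0) as [E|E]; [lra|].
  apply Rabs_pos_lt in E; lra.
Qed.

End HilbertSequences.
Arguments converges {Y}.

(** * Spectral gaps of symmetric operators *)

Definition bounded_below {Y : RHilbert} (S : Y -> Prop) (M : Y -> Y) (c : R) : Prop :=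
  forall x, S x -> c * hnorm x <= hnorm (M x).

Definition onto {Y : RHilbert} (S T : Y -> Prop) (M : Y -> Y) : Prop :=
  forall y, T y -> exists x, S x /\ M x = y.

Definition symmetric_on {Y : RHilbert} (S : Y -> Prop) (M : Y -> Y) : Prop :=
  forall x y, S x -> S y -> inner (M x) y = inner x (M y).

Definition shift {Y : RHilbert} (M : Y -> Y) (nu : R) (x : Y) : Y :=
  vsub (M x) (vscal nu x).

Definition closed_on {Y : RHilbert} (S : Y -> Prop) (M : Y -> Y) : Prop :=
  forall (u : nat -> Y) x z, (forall k, S (u k)) -> converges u x ->
    converges (fun k => M (u k)) z -> S x /\ M x = z.

Section Gap.
Variable Y : RHilbert.
Implicit Types (S T : Y -> Prop) (M : Y -> Y).

Lemma subspace_sub S x y : subspace S -> S x -> S y -> S (vsub x y).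
Proof. intros (H0 & Ha & Hs) Hx Hy; apply Ha; [|apply Hs]; assumption. Qed.

Lemma linear_on_sub S M x y :
  subspace S -> linear_on S M -> S x -> S y -> M (vsub x y) = vsub (M x) (M y).
Proof.
  intros (H0 & Ha & Hs) [La Ls] Hx Hy; unfold vsub.
  rewrite La, Ls; auto.
Qed.

Lemma linear_on_shift S M nu : subspace S -> linear_on S M -> linear_on S (shift M nu).
Proof.
  intros (H0 & Ha & Hs) [La Ls]; split; intros; unfold shift.
  - rewrite La by assumption; hvec.
  - rewrite Ls by assumption; hvec.
Qed.

Lemma symmetric_on_shift S M nu : symmetric_on S M -> symmetric_on S (shift M nu).
Proof.
  intros H x y Hx Hy; unfold shift; inner_expand.
  rewrite (H x y Hx Hy); ring.
Qed.

(** For [x = M x2], the vector [w = m^2 x2 - M x] is [- (M - m) (M + m) x2], so [|w| >= c |x2|]. By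
    symmetry [<x2, M x> = |x|^2], hence [|w|^2 = m^4 |x2|^2 - 2 m^2 |x|^2 + |M x|^2], which is at
    most [|M x|^2 - m^2 |x|^2] because [m |x2| <= |x|]. A lower bound of [|w|] by [|M x|] then
    improves [m]. *)
Lemma bounded_below_improve S M m c1 c2 :
  subspace S -> linear_on S M -> symmetric_on S M ->
  (forall x, S x -> exists x2, S x2 /\ M x2 = x) ->
  0 < m -> bounded_below S M m -> 0 < c1 -> 0 < c2 ->
  bounded_below S (shift M m) c1 -> bounded_below S (shift M (- m)) c2 ->
  exists s, m < s /\ bounded_below S M s.
Proof.
  intros HS HM Hsym Honto Hm Hbb Hc1 Hc2 H1 H2.
  set (c := c1 * c2); assert (Hc : 0 < c) by (unfold c; nra).
  (* [|M x| <= |w| + m^2 |x2| <= (1 + m^2 / c) |w|], that is, [g |M x| <= |w|]. *)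
  set (g := c / (m * m + c)).
  assert (Hden : 0 < m * m + c) by nra.
  assert (Hg : 0 < g) by (apply Rdiv_lt_0_compat; lra).
  assert (Hgm : g * (m * m + c) = c) by (unfold g; field; lra).
  assert (Hg1 : g < 1) by nra.
  assert (Hgg0 : 0 < g * g) by nra.
  (* The estimate obtained is [m^2 |x|^2 <= (1 - g^2) |M x|^2]. The factor [1 + g^2 / 2] replaces
     [1 / sqrt (1 - g^2)] from below, without a square root. *)
  exists (m * (1 + g * g / 2)); split; [nra|].
  intros x Hx; destruct (Honto x Hx) as (x2 & Hx2 & Ex2).
  set (w := vsub (vscal (m * m) x2) (M x)).
  (* [w = - (M - m) (M + m) x2] *)
  assert (Hw : c * hnorm x2 <= hnorm w).
  { pose proof (H2 x2 Hx2) as A2.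
    assert (Su : S (shift M (- m) x2))
      by (unfold shift; rewrite Ex2; apply subspace_sub; auto; apply HS; auto).
    pose proof (H1 _ Su) as A1.
    replace (shift M m (shift M (- m) x2)) with (vscal (-1) w) in A1.
    - rewrite hnorm_scal, Rabs_left in A1 by lra.
      unfold c; pose proof (hnorm_pos _ x2); nra.
    - unfold w; unfold shift at 2; unfold shift.
      rewrite (linear_on_sub S M) by (trivial; try (rewrite Ex2; exact Hx); apply HS; exact Hx2).
      rewrite (proj2 HM) by exact Hx2; rewrite Ex2; unfold w; hvec. }
  assert (Hy : hnorm (M x) <= hnorm w + m * m * hnorm x2).
  { replace (M x) with (vsub (vscal (m * m) x2) w) by (unfold w; hvec).
    eapply Rle_trans; [apply hnorm_sub_triang|].
    rewrite hnorm_scal, Rabs_right by nra; lra. }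
  assert (Hsq : hnorm w * hnorm w =
     m * m * (m * m) * (hnorm x2 * hnorm x2) - 2 * (m * m) * (hnorm x * hnorm x)
     + hnorm (M x) * hnorm (M x)).
  { rewrite !hnorm_sq; unfold w.
    assert (E : inner x2 (M x) = inner x x) by (rewrite <- (Hsym x2 x Hx2 Hx), Ex2; reflexivity).
    inner_expand; rewrite (inner_sym _ (M x) x2), E; ring. }
  pose proof (Hbb x2 Hx2) as B; rewrite Ex2 in B.
  pose proof (hnorm_pos _ x) as P1; pose proof (hnorm_pos _ x2) as P2.
  pose proof (hnorm_pos _ w) as P3; pose proof (hnorm_pos _ (M x)) as P4.
  set (X := hnorm x) in *; set (X2 := hnorm x2) in *; set (W := hnorm w) in *.
  set (U := hnorm (M x)) in *; clearbody X X2 W U.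
  assert (HgW : g * U <= W).
  { apply Rmult_le_reg_l with (m * m + c); [exact Hden|].
    replace ((m * m + c) * (g * U)) with (c * U) by (rewrite <- Hgm at 1; ring).
    assert (m * m * (c * X2) <= m * m * W) by (apply Rmult_le_compat_l; nra).
    nra. }
  assert (HX2 : m * m * (X2 * X2) <= X * X)
    by (replace (m * m * (X2 * X2)) with ((m * X2) * (m * X2)) by ring;
        apply Rmult_le_compat; nra).
  assert (HWU : g * U * (g * U) <= W * W) by (apply Rmult_le_compat; nra).
  assert (K : m * m * (X * X) <= (1 - g * g) * (U * U)).
  { assert (m * m * (m * m * (X2 * X2)) <= m * m * (X * X))
      by (apply Rmult_le_compat_l; nra). nra. }
  apply Rsqr_incr_0_var; [|exact P4]; unfold Rsqr.
  assert (Hgg : 0 < 1 - g * g) by nra.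
  apply Rmult_le_reg_l with (1 - g * g); [exact Hgg|].
  eapply Rle_trans; [|exact K].
  replace ((1 - g * g) * (m * (1 + g * g / 2) * X * (m * (1 + g * g / 2) * X)))
    with ((m * m * (X * X)) * ((1 - g * g) * ((1 + g * g / 2) * (1 + g * g / 2)))) by ring.
  rewrite <- (Rmult_1_r (m * m * (X * X))) at 2.
  apply Rmult_le_compat_l; [nra|].
  set (h := g * g) in *; assert (0 < h) by (unfold h; nra); clearbody h.
  assert (0 <= h * h) by nra; assert (0 <= h * h * h) by nra.
  replace ((1 - h) * ((1 + h / 2) * (1 + h / 2)))
    with (1 - 3 / 4 * (h * h) - h * h * h / 4) by field; lra.
Qed.

(* The best lower bound [m] of [|M x| / |x|] is attained as a spectral value [m] or [-m]. *)
Lemma symmetric_gap S M r :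
  subspace S -> linear_on S M -> symmetric_on S M ->
  (forall x, S x -> exists x2, S x2 /\ M x2 = x) -> 0 <= r ->
  (forall nu, - r <= nu <= r -> exists c, 0 < c /\ bounded_below S (shift M nu) c) ->
  exists s, r < s /\ bounded_below S M s.
Proof.
  (* If no lower bound exceeded [r], the lower bounds would have a supremum [m <= r]. It is itself a
     lower bound, and both [m] and [- m] lie in [[- r, r]], so it could be improved. *)
  intros HS HM Hsym Honto Hr Hnu; apply NNPP; intros Hno.
  set (E := bounded_below S M).
  destruct (completeness E) as [m [Hub Hlub]].
  - exists r; intros s Hs; destruct (Rle_lt_dec s r) as [|Hlt]; [assumption|].
    exfalso; apply Hno; exists s; split; assumption.
  - exists 0; intros x _; rewrite Rmult_0_l; apply hnorm_pos.
  - assert (Hmr : m <= r).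
    { apply Hlub; intros s Hs; destruct (Rle_lt_dec s r) as [|Hlt]; [assumption|].
      exfalso; apply Hno; exists s; split; assumption. }
    assert (Hm0 : 0 < m).
    { destruct (Hnu 0) as (c & Hc & Hb); [lra|].
      apply Rlt_le_trans with c; [exact Hc|]; apply Hub; intros x Hx.
      replace (M x) with (shift M 0 x) by (unfold shift; hvec); apply Hb, Hx. }
    assert (HEm : bounded_below S M m).
    { intros x Hx; pose proof (hnorm_pos _ x) as P.
      destruct (Req_dec (hnorm x) 0) as [E0|E0].
      - rewrite E0, Rmult_0_r; apply hnorm_pos.
      - apply Rmult_le_reg_r with (/ hnorm x); [apply Rinv_0_lt_compat; lra|].
        rewrite Rmult_assoc, Rinv_r, Rmult_1_r by exact E0.
        apply Hlub; intros s Hs; specialize (Hs x Hx).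
        apply Rmult_le_reg_r with (hnorm x); [lra|].
        rewrite Rmult_assoc, Rinv_l, Rmult_1_r; assumption. }
    destruct (Hnu m) as (c1 & Hc1 & H1); [lra|].
    destruct (Hnu (- m)) as (c2 & Hc2 & H2); [lra|].
    destruct (bounded_below_improve S M m c1 c2) as (s & Hs & Hbs); trivial.
    specialize (Hub s Hbs); lra.
Qed.

End Gap.

Lemma Un_cv_0_inv c : Un_cv (fun k => c / (INR k + 1)) 0.
Proof.
  intros eps He.
  destruct (archimed_cor1 (eps / (Rabs c + 1))) as (K & HK & HK0).
  { pose proof (Rabs_pos c); apply Rdiv_lt_0_compat; lra. }
  exists K; intros k Hk; unfold Rdist; rewrite Rminus_0_r.
  assert (Hp : 0 < INR K) by (apply lt_0_INR; lia).
  assert (HkK : INR K <= INR k) by (apply le_INR; lia).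
  unfold Rdiv; rewrite Rabs_mult, (Rabs_right (/ _))
    by (apply Rle_ge, Rlt_le, Rinv_0_lt_compat; lra).
  pose proof (Rabs_pos c) as Hc.
  assert (Hi : / (INR k + 1) < eps / (Rabs c + 1)).
  { eapply Rlt_trans; [|exact HK]; apply Rinv_lt_contravar; nra. }
  assert (Hi0 : 0 < / (INR k + 1)) by (apply Rinv_0_lt_compat; lra).
  set (d := eps / (Rabs c + 1)) in *.
  assert (E : eps = (Rabs c + 1) * d) by (unfold d; field; lra).
  rewrite E; nra.
Qed.

(** * Isolated spectral values with trivial kernel *)

Section Isolated.
Variable Y : RHilbert.
Variables S T : Y -> Prop.
Variable M : Y -> Y.
Variable eps : R.
Hypothesis HS : subspace S.
Hypothesis HST : forall x, S x -> T x.
Hypothesis HM : linear_on S M.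
Hypothesis Hsym : symmetric_on S M.
Hypothesis Hclosed : closed_on S M.
Hypothesis Hinj : forall x, S x -> M x = vzero -> x = vzero.
Hypothesis Heps : 0 < eps.
Hypothesis Hres : forall nu, 0 < Rabs nu < eps ->
  onto S T (shift M nu) /\ exists c, 0 < c /\ bounded_below S (shift M nu) c.

Lemma shift_shift nu nu' x : shift (shift M nu) nu' x = shift M (nu + nu') x.
Proof. unfold shift; hvec. Qed.

(** Within distance [eps] only 0 can be singular for [M]. As [|nu| < eps / 2], every [nu'] with
    [|nu'| < |nu|] is therefore regular for [M - nu], and [symmetric_gap] applies to each radius
    below [|nu|]. *)
Lemma bounded_below_shift nu :
  0 < Rabs nu < eps / 2 -> bounded_below S (shift M nu) (Rabs nu).
Proof.
  intros Hnu x Hx; apply le_epsilon; intros e He.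
  assert (HX : 0 <= hnorm x) by apply hnorm_pos.
  (* The radius falls short of [|nu|] by so little that the loss at this [x] is at most [e]; the
     maximum keeps it nonnegative. *)
  set (r := Rmax 0 (Rabs nu - e / (hnorm x + 1))).
  assert (Hq : 0 < e / (hnorm x + 1)) by (apply Rdiv_lt_0_compat; lra).
  assert (Hr : 0 <= r < Rabs nu)
    by (split; [apply Rmax_l|apply Rmax_lub_lt; lra]).
  destruct (symmetric_gap Y S (shift M nu) r) as (s & Hs & Hb); trivial.
  - apply linear_on_shift; trivial.
  - apply symmetric_on_shift; trivial.
  - intros y Hy; apply (proj1 (Hres nu ltac:(lra))), HST, Hy.
  - lra.
  - intros nu' Hnu'.
    destruct (Hres (nu + nu')) as [_ (c & Hc & Hb)].
    + assert (Hle : Rabs nu' <= r) by (apply Rabs_le; lra).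
      split.
      * pose proof (Rabs_triang_inv nu (- nu')) as A; rewrite Rabs_Ropp in A.
        replace (nu - - nu') with (nu + nu') in A by ring; lra.
      * pose proof (Rabs_triang nu nu'); lra.
    + exists c; split; [exact Hc|]; intros y Hy; rewrite shift_shift; apply Hb, Hy.
  - specialize (Hb x Hx).
    assert (Hle : Rabs nu - e / (hnorm x + 1) <= r) by apply Rmax_r.
    assert (E : e = e / (hnorm x + 1) * (hnorm x + 1)) by (field; lra).
    set (q := e / (hnorm x + 1)) in *; nra.
Qed.

(* Polarisation of [2 e |<M x, x>| <= |M x|^2]. *)
Lemma bounded_below_range e x :
  0 < e < eps / 2 -> S x -> S (M x) -> 2 * e * hnorm (M x) <= hnorm (M (M x)).
Proof.
  intros He Hx Hv.
  (* Squaring [|M z - nu z| >= |nu| |z|] cancels the two terms [nu^2 |z|^2]. *)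
  assert (Q : forall nu z, Rabs nu = e -> S z -> 2 * nu * inner (M z) z <= inner (M z) (M z)).
  { intros nu z Hnu Hz.
    pose proof (bounded_below_shift nu ltac:(lra) z Hz) as B.
    assert (B2 : Rabs nu * hnorm z * (Rabs nu * hnorm z)
                 <= hnorm (shift M nu z) * hnorm (shift M nu z))
      by (pose proof (hnorm_pos _ z); pose proof (Rabs_pos nu); apply Rmult_le_compat; nra).
    replace (Rabs nu * hnorm z * (Rabs nu * hnorm z))
      with (Rabs nu * Rabs nu * (hnorm z * hnorm z)) in B2 by ring.
    rewrite <- Rabs_mult, Rabs_right in B2 by nra; rewrite !hnorm_sq in B2.
    unfold shift in B2; revert B2; inner_expand.
    rewrite (inner_sym _ z (M z)); lra. }
  set (v := M x) in *.
  (* Adding [Q] at [y + v] for [e] and at [y - v] for [- e] gives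
     [8 e <M y, v> <= 2 |M y|^2 + 2 |M v|^2]. With [M y = 2 e v] the left side is [16 e^2 |v|^2],
     and half of it absorbs [2 |M y|^2]. *)
  set (y := vscal (2 * e) x).
  assert (Hy : S y) by (apply HS; exact Hx).
  assert (My : M y = vscal (2 * e) v) by (apply HM; exact Hx).
  pose proof (Q e (vadd y v) ltac:(rewrite Rabs_right; lra) ltac:(apply HS; auto)) as Q1.
  pose proof (Q (- e) (vsub y v) ltac:(rewrite Rabs_Ropp, Rabs_right; lra)
                ltac:(apply subspace_sub; auto)) as Q2.
  rewrite (linear_on_sub Y S M) in Q2 by auto.
  rewrite (proj1 HM) in Q1 by auto.
  rewrite My in Q1, Q2.
  apply Rsqr_incr_0_var; [|apply hnorm_pos]; unfold Rsqr.
  replace (2 * e * hnorm v * (2 * e * hnorm v)) with (4 * (e * e) * (hnorm v * hnorm v)) by ring.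
  assert (E1 : inner (M v) y = 2 * e * inner v v).
  { unfold y; rewrite inner_scal_r, (Hsym v x) by auto; reflexivity. }
  rewrite !hnorm_sq.
  revert Q1 Q2; inner_expand; rewrite (inner_sym _ v (M v)), E1.
  unfold y; inner_expand.
  nra.
Qed.

(** Shifts tending to 0. The [+ 2] keeps them below [eps / 8], well under the lower bound [eps / 2]
    that has to absorb them in [isolated_onto]. *)
Definition step (k : nat) : R := eps / 4 / (INR k + 2).

Lemma step_bound k : 0 < step k < eps / 2.
Proof.
  unfold step; pose proof (pos_INR k); split.
  - apply Rdiv_lt_0_compat; lra.
  - apply Rmult_lt_reg_r with (INR k + 2); [lra|].
    unfold Rdiv at 1; rewrite Rmult_assoc, Rinv_l by lra; nra.
Qed.

Lemma step_cv c : Un_cv (fun k => step k * c) 0.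
Proof.
  intros eta He.
  destruct (Un_cv_0_inv (eps / 4 * c) eta He) as [K HK]; exists K; intros k Hk.
  specialize (HK (Datatypes.S k) ltac:(lia)); rewrite S_INR in HK.
  replace (step k * c) with (eps / 4 * c / (INR k + 1 + 1)); [exact HK|].
  unfold step; pose proof (pos_INR k); field; lra.
Qed.

Section Approximation.
Variables (y : Y) (a : nat -> Y).
Hypothesis Ha : forall k, S (a k).
Hypothesis Eq : forall k, shift M (step k) (a k) = y.

Lemma range_converges : converges (fun k => M (a k)) y.
Proof.
  (* The differences of the errors [q k] lie in the range of [M], where [M] is bounded
     below, while [M (q k)] tends to 0: hence [q k] converges to an element of the kernel. *)
  set (q k := vscal (- step k) (a k)).
  assert (Eq' : forall k, M (a k) = vsub y (q k))
    by (intros k; rewrite <- (Eq k); unfold q, shift; hvec).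
  assert (Sq : forall k, S (q k)) by (intros; apply HS; trivial).
  assert (Mq : forall k, M (q k) = vscal (- step k) (vsub y (q k)))
    by (intros k; rewrite <- Eq'; apply HM; trivial).
  assert (Bq : forall k, hnorm (q k) <= hnorm y).
  { intros k; pose proof (step_bound k) as Hd.
    pose proof (bounded_below_shift (step k)) as B; rewrite Rabs_right in B by lra.
    specialize (B Hd (a k) (Ha k)); rewrite Eq in B.
    unfold q; rewrite hnorm_scal, Rabs_Ropp, Rabs_right by lra; exact B. }
  assert (BM : forall k, hnorm (M (q k)) <= step k * (2 * hnorm y)).
  { intros k; pose proof (step_bound k) as Hd.
    rewrite Mq, hnorm_scal, Rabs_Ropp, Rabs_right by lra.
    apply Rmult_le_compat_l; [lra|].
    eapply Rle_trans; [apply hnorm_sub_triang|]; specialize (Bq k); lra. }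
  (* Here [q m - q k = M (a k - a m)], so [bounded_below_range] with [e = eps / 4] gives [eps / 2 *
     |q m - q k| <= |M (q m)| + |M (q k)|]. *)
  assert (Cq : forall m k, hnorm (vsub (q m) (q k))
              <= step m * (2 * hnorm y / (eps / 2)) + step k * (2 * hnorm y / (eps / 2))).
  { intros m k.
    assert (E : vsub (q m) (q k) = M (vsub (a k) (a m)))
      by (rewrite (linear_on_sub Y S M), !Eq' by auto; hvec).
    pose proof (bounded_below_range (eps / 4) (vsub (a k) (a m))) as B.
    rewrite <- E, (linear_on_sub Y S M) in B by auto.
    specialize (B ltac:(lra) ltac:(apply subspace_sub; auto)
                  ltac:(apply subspace_sub; auto)).
    pose proof (hnorm_sub_triang _ (M (q m)) (M (q k))) as Tr.
    pose proof (BM m); pose proof (BM k).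
    assert (He : 0 < eps / 2) by (lra).
    apply Rmult_le_reg_l with (eps / 2); [exact He|].
    replace (eps / 2 * (step m * (2 * hnorm y / (eps / 2)) + step k * (2 * hnorm y / (eps / 2))))
      with (step m * (2 * hnorm y) + step k * (2 * hnorm y)) by (field; lra); lra. }
  destruct (complete_of_bound Y q _ Cq (step_cv _)) as [l Hl].
  assert (HMl : S l /\ M l = vzero).
  { apply (Hclosed q); trivial.
    apply converges_of_bound with (d := fun k => step k * (2 * hnorm y)); [|apply step_cv].
    intros m; replace (vsub (M (q m)) vzero) with (M (q m)) by hvec; apply BM. }
  rewrite (Hinj l (proj1 HMl) (proj2 HMl)) in Hl.
  intros eta Heta; destruct (Hl eta Heta) as [K HK]; exists K; intros k Hk.
  rewrite Eq', hnorm_sub_sym.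
  replace (vsub y (vsub y (q k))) with (vsub (q k) vzero) by hvec; auto.
Qed.

End Approximation.

Lemma approximate_solution y : T y ->
  exists a : nat -> Y, (forall k, S (a k)) /\ converges (fun k => M (a k)) y /\
    forall k, shift M (step k) (a k) = y.
Proof.
  intros Hy.
  assert (H : forall k, exists x, S x /\ shift M (step k) x = y).
  { intros k; pose proof (step_bound k) as Hb.
    apply (Hres (step k)); [|exact Hy].
    rewrite Rabs_right; lra. }
  exists (fun k => proj1_sig (constructive_indefinite_description _ (H k))).
  assert (Ha : forall k, S (proj1_sig (constructive_indefinite_description _ (H k))))
    by (intros k; apply (proj2_sig (constructive_indefinite_description _ (H k)))).
  assert (Eq : forall k, shift M (step k)
                 (proj1_sig (constructive_indefinite_description _ (H k))) = y)
    by (intros k; apply (proj2_sig (constructive_indefinite_description _ (H k)))).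
  split; [exact Ha|split; [apply range_converges; trivial|exact Eq]].
Qed.

(** [bounded_below_range] only covers vectors [M x] that lie in [S]. For [y] in [S] the approximants
    [M (a k) = y + step k * a k] are of this kind, and [M (M (a k)) - M y = step k * M (a k)] tends
    to 0, so the bound passes to the limit. *)
Lemma isolated_bounded_below : bounded_below S M (eps / 2).
Proof.
  intros y Hy.
  destruct (approximate_solution y (HST y Hy)) as (a & Ha & Hc & Eq).
    assert (SM : forall k, S (M (a k))).
  { intros k; replace (M (a k)) with (vadd y (vscal (step k) (a k)))
      by (rewrite <- (Eq k); unfold shift; hvec).
    apply HS; [exact Hy|apply HS, Ha]. }
  assert (EM : forall k, vsub (M (M (a k))) (M y) = vscal (step k) (M (a k))).
  { intros k; rewrite <- (linear_on_sub Y S M) by auto.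
    replace (vsub (M (a k)) y) with (vscal (step k) (a k))
      by (rewrite <- (Eq k); unfold shift; hvec).
    apply HM, Ha. }
  apply le_epsilon; intros eta Heta.
  pose proof (hnorm_pos _ y) as Py.
  (* The errors add up to at most [h (eps + |y| + 1)]; the bound [h <= 1] makes the quadratic term
     linear. *)
  set (h := Rmin 1 (eta / (eps + hnorm y + 1))).
  assert (Hh0 : 0 < eta / (eps + hnorm y + 1)) by (apply Rdiv_lt_0_compat; lra).
  assert (Hh : 0 < h) by (apply Rmin_glb_lt; lra).
  destruct (Hc h Hh) as [K1 HK1].
  destruct (step_cv 1 h Hh) as [K2 HK2].
  set (k := max K1 K2).
  specialize (HK1 k ltac:(lia)); specialize (HK2 k ltac:(lia)).
  pose proof (step_bound k) as Hd.
  unfold Rdist in HK2; rewrite Rminus_0_r, Rmult_1_r, Rabs_right in HK2 by lra.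
  pose proof (bounded_below_range (eps / 4) (a k) ltac:(lra) (Ha k) (SM k)) as B.
  assert (N1 : hnorm y <= hnorm (M (a k)) + h)
    by (pose proof (hnorm_le_sub _ y (M (a k))) as A; rewrite hnorm_sub_sym in A; lra).
  assert (N2 : hnorm (M (a k)) <= hnorm y + h)
    by (pose proof (hnorm_le_sub _ (M (a k)) y); lra).
  assert (N3 : hnorm (M (M (a k))) <= hnorm (M y) + step k * hnorm (M (a k))).
  { pose proof (hnorm_le_sub _ (M (M (a k))) (M y)) as A.
    rewrite EM, hnorm_scal, Rabs_right in A by lra; exact A. }
  assert (h1 : h <= 1) by apply Rmin_l.
  assert (h2 : h * (eps + hnorm y + 1) <= eta).
  { apply Rle_trans with (eta / (eps + hnorm y + 1) * (eps + hnorm y + 1)).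
    - apply Rmult_le_compat_r; [lra|apply Rmin_r].
    - right; field; lra. }
  pose proof (hnorm_pos _ (M (a k))); nra.
Qed.

(** The lower bound [eps / 2] keeps the solutions [a k] bounded. As [M (a m) - M (a k) = step m * a
    m - step k * a k], the same bound makes them Cauchy, and closedness identifies the image of the
    limit as [y]. *)
Lemma isolated_onto : onto S T M.
Proof.
  intros y Hy.
  destruct (approximate_solution y Hy) as (a & Ha & Hc & Eq).
    assert (Hd : forall k, 0 < step k <= eps / 8).
  { intros k; split; [apply step_bound|]; unfold step; pose proof (pos_INR k).
    apply Rmult_le_reg_r with (INR k + 2); [lra|].
    unfold Rdiv at 1; rewrite Rmult_assoc, Rinv_l by lra; nra. }
  assert (B : forall k, hnorm (a k) <= hnorm y * (4 / eps)).
  { intros k; pose proof (isolated_bounded_below (a k) (Ha k)) as B.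
    assert (E : M (a k) = vadd y (vscal (step k) (a k)))
      by (rewrite <- (Eq k); unfold shift; hvec).
    pose proof (hnorm_triang _ y (vscal (step k) (a k))) as Tr.
    rewrite <- E, hnorm_scal, Rabs_right in Tr by (specialize (Hd k); lra).
    specialize (Hd k); pose proof (hnorm_pos _ (a k)).
    apply Rmult_le_reg_l with eps; [lra|].
    replace (eps * (hnorm y * (4 / eps))) with (4 * hnorm y) by (field; lra).
    nra. }
  assert (C : forall m k, hnorm (vsub (a m) (a k)) <=
     step m * (hnorm y * (4 / eps) * (2 / eps)) + step k * (hnorm y * (4 / eps) * (2 / eps))).
  { intros m k.
    pose proof (isolated_bounded_below (vsub (a m) (a k))) as Bk.
    specialize (Bk ltac:(apply subspace_sub; auto)).
    rewrite (linear_on_sub Y S M) in Bk by auto.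
    replace (vsub (M (a m)) (M (a k))) with (vsub (vscal (step m) (a m)) (vscal (step k) (a k))) in Bk.
    - pose proof (hnorm_sub_triang _ (vscal (step m) (a m)) (vscal (step k) (a k))) as Tr.
      pose proof (Hd m); pose proof (Hd k).
      rewrite !hnorm_scal, !Rabs_right in Tr by lra.
      pose proof (B m); pose proof (B k).
      assert (step m * hnorm (a m) <= step m * (hnorm y * (4 / eps))) by (apply Rmult_le_compat_l; lra).
      assert (step k * hnorm (a k) <= step k * (hnorm y * (4 / eps))) by (apply Rmult_le_compat_l; lra).
      apply Rmult_le_reg_l with (eps / 2); [lra|].
      replace (eps / 2 * (step m * (hnorm y * (4 / eps) * (2 / eps))
                          + step k * (hnorm y * (4 / eps) * (2 / eps))))
        with (step m * (hnorm y * (4 / eps)) + step k * (hnorm y * (4 / eps))) by (field; lra).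
      lra.
    - transitivity (vsub (vsub (M (a m)) (shift M (step m) (a m)))
                         (vsub (M (a k)) (shift M (step k) (a k)))).
      + unfold shift; hvec.
      + rewrite !Eq; hvec. }
  destruct (complete_of_bound Y a _ C (step_cv _)) as [x Hx].
  exists x; apply (Hclosed a); trivial.
Qed.

End Isolated.

(** * Lipschitz perturbations *)

Section LipschitzPerturbation.
Variable Y : RHilbert.
Variables S T : Y -> Prop.
Variables A G : Y -> Y.
Variables n m : R.
Hypothesis HS : subspace S.
Hypothesis HT : subspace T.
Hypothesis HA : linear_on S A.
Hypothesis HAT : forall x, S x -> T (A x).
Hypothesis Hclosed : closed_on S A.
Hypothesis Hbb : bounded_below S A m.
Hypothesis Honto : onto S T A.
Hypothesis Hn : 0 <= n < m.
Hypothesis HGT : forall x, S x -> T (G x).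
Hypothesis HG : forall x y, S x -> S y -> hnorm (vsub (G x) (G y)) <= n * hnorm (vsub x y).

Lemma solve_ex z (Hz : T z) (w : {x | S x}) :
  exists v : {x | S x}, A (proj1_sig v) = vadd z (G (proj1_sig w)).
Proof.
  destruct (Honto (vadd z (G (proj1_sig w)))) as (v & Hv & E).
  - apply HT; [exact Hz|apply HGT, proj2_sig].
  - exists (exist _ v Hv); exact E.
Qed.

(** The iterates are packed with their membership in [S], since [G] is only controlled there. *)
Definition picard_step z (Hz : T z) (w : {x | S x}) : {x | S x} :=
  proj1_sig (constructive_indefinite_description _ (solve_ex z Hz w)).

Lemma picard_step_spec z Hz w :
  A (proj1_sig (picard_step z Hz w)) = vadd z (G (proj1_sig w)).
Proof. apply (proj2_sig (constructive_indefinite_description _ (solve_ex z Hz w))). Qed.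

Fixpoint picard z (Hz : T z) (k : nat) : {x | S x} :=
  match k with
  | O => exist _ vzero (proj1 HS)
  | Datatypes.S j => picard_step z Hz (picard z Hz j)
  end.

Lemma picard_contract z Hz k :
  m * hnorm (vsub (proj1_sig (picard z Hz (k + 2))) (proj1_sig (picard z Hz (k + 1)))) <=
  n * hnorm (vsub (proj1_sig (picard z Hz (k + 1))) (proj1_sig (picard z Hz k))).
Proof.
  replace (k + 2)%nat with (Datatypes.S (k + 1)) by lia.
  replace (k + 1)%nat with (Datatypes.S k) by lia; simpl.
  set (w := picard z Hz k); set (v := picard_step z Hz w).
  pose proof (Hbb (vsub (proj1_sig (picard_step z Hz v)) (proj1_sig v))) as B.
  assert (E : A (proj1_sig v) = vadd z (G (proj1_sig w))) by apply picard_step_spec.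
  rewrite (linear_on_sub Y S A), picard_step_spec, E in B
    by (trivial; apply proj2_sig).
  eapply Rle_trans; [apply B|].
  - apply subspace_sub; trivial; apply proj2_sig.
  - replace (vsub (vadd z (G (proj1_sig v))) (vadd z (G (proj1_sig w))))
      with (vsub (G (proj1_sig v)) (G (proj1_sig w))) by hvec.
    apply HG; apply proj2_sig.
Qed.

Lemma picard_cauchy z Hz : exists l, converges (fun k => proj1_sig (picard z Hz k)) l.
Proof.
  set (w k := proj1_sig (picard z Hz k)).
  set (q := n / m).
  assert (Hq : 0 <= q < 1).
  { unfold q; split; [apply Rmult_le_pos; [lra|left; apply Rinv_0_lt_compat; lra]|].
    apply Rmult_lt_reg_r with m; [lra|].
    unfold Rdiv; rewrite Rmult_assoc, Rinv_l by lra; lra. }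
  set (C := hnorm (vsub (w 1%nat) (w 0%nat))).
  assert (HC : 0 <= C) by apply hnorm_pos.
  assert (Hpow : forall k, 0 <= q ^ k) by (intros; apply pow_le; lra).
  assert (Hstep : forall k, hnorm (vsub (w (k + 1)%nat) (w k)) <= C * q ^ k).
  { induction k as [|k IH]; [simpl; fold C; lra|].
    pose proof (picard_contract z Hz k) as P.
    replace (Datatypes.S k + 1)%nat with (k + 2)%nat by lia.
    replace (Datatypes.S k) with (k + 1)%nat at 1 by lia.
    apply Rmult_le_reg_l with m; [lra|]; eapply Rle_trans; [exact P|].
    replace (m * (C * q ^ Datatypes.S k)) with (n * (C * q ^ k))
      by (simpl; unfold q at 2; field; lra).
    apply Rmult_le_compat_l; [lra|exact IH]. }
  (* The telescoped geometric sum, multiplied by [1 - q] so that the induction involves no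
     division. *)
  assert (Hfar : forall j k, (1 - q) * hnorm (vsub (w (k + j)%nat) (w k)) <= C * (q ^ k - q ^ (k + j))).
  { induction j as [|j IH]; intros k.
    - rewrite Nat.add_0_r, vsub_self, hnorm_vzero; lra.
    - replace (vsub (w (k + Datatypes.S j)%nat) (w k))
        with (vadd (vsub (w (k + j + 1)%nat) (w (k + j)%nat)) (vsub (w (k + j)%nat) (w k))).
      + eapply Rle_trans; [apply Rmult_le_compat_l; [lra|apply hnorm_triang]|].
        specialize (IH k); specialize (Hstep (k + j)%nat).
        replace (q ^ (k + Datatypes.S j)) with (q * q ^ (k + j))
          by (rewrite Nat.add_succ_r; reflexivity).
        apply Rmult_le_compat_l with (r := 1 - q) in Hstep; lra.
      + replace (k + Datatypes.S j)%nat with (k + j + 1)%nat by lia; hvec. }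
  assert (Hfar' : forall j k, hnorm (vsub (w (k + j)%nat) (w k)) <= C / (1 - q) * q ^ k).
  { intros j k; apply Rmult_le_reg_l with (1 - q); [lra|].
    eapply Rle_trans; [apply Hfar|].
    replace ((1 - q) * (C / (1 - q) * q ^ k)) with (C * q ^ k) by (field; lra).
    specialize (Hpow (k + j)%nat); nra. }
  assert (HD : 0 <= C / (1 - q))
    by (apply Rmult_le_pos; [exact HC|left; apply Rinv_0_lt_compat; lra]).
  apply complete_of_bound with (d := fun k => C / (1 - q) * q ^ k).
  - intros i k; pose proof (Hpow i); pose proof (Hpow k).
    destruct (Nat.le_ge_cases i k) as [Hl|Hl].
    + rewrite hnorm_sub_sym; replace k with (i + (k - i))%nat at 1 by lia.
      specialize (Hfar' (k - i)%nat i); nra.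
    + replace i with (k + (i - k))%nat at 1 by lia.
      specialize (Hfar' (i - k)%nat k); nra.
  - intros eps He.
    destruct (pow_lt_1_zero q) with (y := eps / (C / (1 - q) + 1)) as [K HK].
    + rewrite Rabs_right; lra.
    + apply Rdiv_lt_0_compat; lra.
    + exists K; intros k Hk; specialize (HK k Hk); specialize (Hpow k).
      unfold Rdist; rewrite Rminus_0_r, Rabs_right by nra.
      rewrite Rabs_right in HK by lra.
      set (c := C / (1 - q)) in *; set (d := eps / (c + 1)) in *.
      assert (E : eps = (c + 1) * d) by (unfold d; field; lra); nra.
Qed.

(** The limit [w] is first known only in [Y], where nothing is assumed of [G]. The images
    [A (u (k + 1)) = z + G (u k)] are Cauchy, by the Lipschitz bound between iterates, so closedness
    of [A] puts [w] in [S]. Only then does [G (u k)] converge to [G w], and closedness is used a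
    second time to get the equation. *)
Lemma perturbed_solve z : T z -> exists w, S w /\ vsub (A w) (G w) = z.
Proof.
  intros Hz; destruct (picard_cauchy z Hz) as [w Hw].
  set (u k := proj1_sig (picard z Hz k)) in *.
  assert (Su : forall k, S (u k)) by (intros; apply proj2_sig).
  assert (EA : forall k, A (u (k + 1)%nat) = vadd z (G (u k)))
    by (intros k; rewrite Nat.add_1_r; apply picard_step_spec).
  assert (Hshift : converges (fun k => u (k + 1)%nat) w).
  { intros eps He; destruct (Hw eps He) as [K HK]; exists K; intros k Hk; apply HK; lia. }
  assert (Sw : S w).
  { destruct (complete_of_bound Y (fun k => A (u (k + 1)%nat))
                (fun k => n * hnorm (vsub (u k) w))) as [y Hy].
    - intros i k; rewrite !EA.
      replace (vsub (vadd z (G (u i))) (vadd z (G (u k)))) with (vsub (G (u i)) (G (u k))) by hvec.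
      eapply Rle_trans; [apply HG; trivial|].
      replace (vsub (u i) (u k)) with (vsub (vsub (u i) w) (vsub (u k) w)) by hvec.
      pose proof (hnorm_sub_triang _ (vsub (u i) w) (vsub (u k) w)); nra.
    - intros eps He; destruct (Hw (eps / (n + 1))) as [K HK]; [apply Rdiv_lt_0_compat; lra|].
      exists K; intros k Hk; specialize (HK k Hk); pose proof (hnorm_pos _ (vsub (u k) w)).
      unfold Rdist; rewrite Rminus_0_r, Rabs_right by nra.
      assert (E : eps = (n + 1) * (eps / (n + 1))) by (field; lra); nra.
    - apply (Hclosed (fun k => u (k + 1)%nat) w y); trivial. }
  exists w; split; [exact Sw|].
  assert (E : A w = vadd z (G w)).
  { apply (Hclosed (fun k => u (k + 1)%nat) w); trivial.
    intros eps He; destruct (Hw (eps / (n + 1))) as [K HK]; [apply Rdiv_lt_0_compat; lra|].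
    exists K; intros k Hk; specialize (HK k Hk); rewrite EA.
    replace (vsub (vadd z (G (u k))) (vadd z (G w))) with (vsub (G (u k)) (G w)) by hvec.
    eapply Rle_lt_trans; [apply HG; trivial|]; pose proof (hnorm_pos _ (vsub (u k) w)).
    assert (E : eps = (n + 1) * (eps / (n + 1))) by (field; lra); nra. }
  rewrite E; hvec.
Qed.

(** With [d = x - y] and [z] the difference of the images, [m |d| <= |A d| <= |z| + n |d|]. So
    [|d| <= |z| / (m - n)], and the graph norm of [d] is at most [(1 + n) |d| + |z|]. *)
Lemma perturbed_lower_bound x y : S x -> S y ->
  graph_norm A (vsub x y) <=
  ((1 + n) / (m - n) + 1) * hnorm (vsub (vsub (A x) (G x)) (vsub (A y) (G y))).
Proof.
  intros Hx Hy; unfold graph_norm.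
  set (z := vsub (vsub (A x) (G x)) (vsub (A y) (G y))).
  assert (E : A (vsub x y) = vadd z (vsub (G x) (G y)))
    by (rewrite (linear_on_sub Y S A) by trivial; unfold z; hvec).
  pose proof (Hbb (vsub x y) ltac:(apply subspace_sub; trivial)) as B.
  pose proof (hnorm_triang _ z (vsub (G x) (G y))) as Tr; rewrite <- E in Tr.
  pose proof (HG x y Hx Hy) as Lp.
  assert (B1 : hnorm (vsub x y) <= hnorm z / (m - n)).
  { apply Rmult_le_reg_r with (m - n); [lra|].
    unfold Rdiv; rewrite Rmult_assoc, Rinv_l by lra; lra. }
  replace (((1 + n) / (m - n) + 1) * hnorm z)
    with ((1 + n) * (hnorm z / (m - n)) + hnorm z) by (field; lra); nra.
Qed.

Lemma perturbed_bilip : exists g,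
  bilip_homeo_with S T (graph_norm A) hnorm (fun x => vsub (A x) (G x)) g
    (1 + n) ((1 + n) / (m - n) + 1).
Proof.
  (* The premise [T z] sits under the existential so that the chosen [g] is total on [Y], with an
     arbitrary value off [T]. *)
  assert (Hex : forall z, exists w, T z -> S w /\ vsub (A w) (G w) = z).
  { intros z; destruct (classic (T z)) as [Hz|Hz].
    - destruct (perturbed_solve z Hz) as [w Hw]; exists w; auto.
    - exists vzero; intros H; contradiction. }
  pose (g z := proj1_sig (constructive_indefinite_description _ (Hex z))).
  assert (Hg : forall z, T z -> S (g z) /\ vsub (A (g z)) (G (g z)) = z)
    by (intros z; apply (proj2_sig (constructive_indefinite_description _ (Hex z)))).
  clearbody g; exists g.
  assert (Hmap : forall x, S x -> T (vsub (A x) (G x)))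
    by (intros x Hx; apply subspace_sub; auto).
  split; [exact Hmap|].
  split; [intros z Hz; apply Hg, Hz|].
  split; [|split; [intros z Hz; apply Hg, Hz|split]].
  - intros x Hx; destruct (Hg _ (Hmap x Hx)) as [H1 H2].
    apply vsub_zero_eq, hnorm_le0.
    pose proof (perturbed_lower_bound (g (vsub (A x) (G x))) x H1 Hx) as B.
    rewrite H2, vsub_self, hnorm_vzero in B; unfold graph_norm in B.
    pose proof (hnorm_pos _ (A (vsub (g (vsub (A x) (G x))) x))); lra.
  - intros x y Hx Hy; unfold graph_norm.
    replace (vsub (vsub (A x) (G x)) (vsub (A y) (G y)))
      with (vsub (A (vsub x y)) (vsub (G x) (G y)))
      by (rewrite (linear_on_sub Y S A) by trivial; hvec).
    eapply Rle_trans; [apply hnorm_sub_triang|].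
    pose proof (HG x y Hx Hy).
    pose proof (hnorm_pos _ (vsub x y)); pose proof (hnorm_pos _ (A (vsub x y))); nra.
  - intros y1 y2 H1 H2.
    destruct (Hg y1 H1) as [S1 E1]; destruct (Hg y2 H2) as [S2 E2].
    pose proof (perturbed_lower_bound _ _ S1 S2) as B; rewrite E1, E2 in B; exact B.
Qed.

End LipschitzPerturbation.

(** * Self-adjoint operators on the complement of a simple eigenvector *)

Lemma converges_inner_lim (Y : RHilbert) (u : nat -> Y) x y eps :
  converges u x -> 0 < eps ->
  exists K, forall k, (K <= k)%nat -> Rabs (inner (u k) y - inner x y) < eps.
Proof.
  intros Hu He; pose proof (hnorm_pos _ y) as Hy.
  destruct (Hu (eps / (hnorm y + 1))) as [K HK]; [apply Rdiv_lt_0_compat; lra|].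
  exists K; intros k Hk; specialize (HK k Hk).
  replace (inner (u k) y - inner x y) with (inner (vsub (u k) x) y) by (inner_expand; ring).
  eapply Rle_lt_trans; [apply cauchy_schwarz|].
  assert (E : eps = eps / (hnorm y + 1) * (hnorm y + 1)) by (field; lra).
  pose proof (hnorm_pos _ (vsub (u k) x)); nra.
Qed.

Lemma converges_inner_eq (Y : RHilbert) (u v : nat -> Y) x z a b :
  converges u x -> converges v z -> (forall k, inner (u k) a = inner (v k) b) ->
  inner x a = inner z b.
Proof.
  intros Hu Hv E; apply cond_eq; intros eps He.
  destruct (converges_inner_lim Y u x a (eps / 2) Hu) as [K1 H1]; [lra|].
  destruct (converges_inner_lim Y v z b (eps / 2) Hv) as [K2 H2]; [lra|].
  specialize (H1 (max K1 K2) ltac:(lia)); specialize (H2 (max K1 K2) ltac:(lia)).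
  rewrite E in H1; apply Rabs_def2 in H1; apply Rabs_def2 in H2; apply Rabs_def1; lra.
Qed.

(** The graph of [L] is that of its adjoint, which is cut out by the identities [<L y, x> = <y, z>];
    these survive limits in [x] and [z]. *)
Lemma self_adjoint_closed (Y : RHilbert) (D : Y -> Prop) (L : Y -> Y) :
  self_adjoint D L -> closed_on D L.
Proof.
  intros (HS & _ & HL & Hsym & Hadj) u x z Hu Hx Hz; apply Hadj; intros y Hy.
  rewrite (inner_sym _ (L y)), (inner_sym _ y).
  apply (converges_inner_eq Y u (fun k => L (u k))); trivial.
  intros k; rewrite inner_sym; symmetry; rewrite inner_sym; symmetry; auto.
Qed.

Section SpectralGap.
Variable Y : RHilbert.
Variable D : Y -> Prop.
Variable L : Y -> Y.
Variables (lam : R) (phi : Y).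
Hypothesis HL : self_adjoint D L.
Hypothesis Heig : simple_isolated_eigen D L lam phi.

Lemma subspace_HY : subspace (HY phi).
Proof.
  unfold HY; split; [apply inner_vzero_l|split]; intros.
  - rewrite inner_add; lra.
  - rewrite inner_scal, H; ring.
Qed.

Lemma subspace_HX : subspace (HX D phi).
Proof.
  destruct HL as (HD & _); destruct subspace_HY as (T0 & Ta & Ts).
  split; [split; [apply HD|apply T0]|split].
  - intros x y [Dx Ex] [Dy Ey]; split; [apply HD; trivial|apply Ta; trivial].
  - intros a x [Dx Ex]; split; [apply HD; trivial|apply Ts; trivial].
Qed.

Lemma linear_on_HX : linear_on (HX D phi) L.
Proof.
  destruct HL as (_ & _ & [La Ls] & _); split.
  - intros x y [Dx _] [Dy _]; auto.
  - intros a x [Dx _]; auto.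
Qed.

Lemma symmetric_on_HX : symmetric_on (HX D phi) L.
Proof.
  destruct HL as (_ & _ & _ & Hsym & _); intros x y [Dx _] [Dy _]; auto.
Qed.

Lemma L_HX_HY x : HX D phi x -> HY phi (L x).
Proof.
  destruct HL as (_ & _ & _ & Hsym & _); destruct Heig as (Dphi & Ephi & _).
  intros [Dx Ex]; unfold HY.
  rewrite Hsym, Ephi, inner_scal_r, Ex by trivial; ring.
Qed.

Lemma closed_on_HX mu : closed_on (HX D phi) (shift L mu).
Proof.
  intros u x z Hu Hx Hz.
  destruct (self_adjoint_closed Y D L HL u x (vadd z (vscal mu x))) as [Dx Ex].
  - intros k; apply Hu.
  - exact Hx.
  - pose proof (converges_lincomb Y _ _ 1 mu _ _ Hz Hx) as H.
    replace (vadd z (vscal mu x)) with (vadd (vscal 1 z) (vscal mu x)) by hvec.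
    intros eps He; destruct (H eps He) as [K HK]; exists K; intros k Hk.
    replace (L (u k)) with (vadd (vscal 1 (shift L mu (u k))) (vscal mu (u k)))
      by (unfold shift; hvec); auto.
  - split; [split; [exact Dx|]|unfold shift; rewrite Ex; hvec].
    apply (converges_inner Y u); trivial; intros k; apply Hu.
Qed.

(** The resolvent preserves orthogonality to [phi]: by symmetry [<y, phi> = (lam - mu) <Rm y, phi>],
    and [lam - mu] is nonzero. *)
Lemma resolvent_HX mu : mu <> lam -> in_resolvent D L mu ->
  onto (HX D phi) (HY phi) (shift L mu) /\
  exists c, 0 < c /\ bounded_below (HX D phi) (shift L mu) c.
Proof.
  destruct HL as (_ & _ & _ & Hsym & _); destruct Heig as (Dphi & Ephi & _).
  intros Hne (Rm & HR & HR' & C & HC); split.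
  - intros y Hy; destruct (HR y) as [DR ER]; exists (Rm y); split; [|exact ER].
    split; [exact DR|].
    unfold HY in Hy; rewrite <- ER in Hy; revert Hy; inner_expand.
    rewrite Hsym, Ephi, inner_scal_r by trivial; intros Hy.
    apply Rmult_eq_reg_l with (lam - mu); lra.
  - pose proof (Rmax_l 1 C) as H1; pose proof (Rmax_r 1 C) as H2.
    (* The constant [C] of the resolvent may be zero or negative; the maximum with 1 can be
       inverted. *)
    exists (/ Rmax 1 C); split; [apply Rinv_0_lt_compat; lra|].
    intros x [Dx _]; pose proof (HC (shift L mu x)) as B.
    unfold shift in B at 1; rewrite HR' in B by exact Dx.
    apply Rmult_le_reg_l with (Rmax 1 C); [lra|].
    rewrite <- Rmult_assoc, Rinv_r, Rmult_1_l by lra.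
    pose proof (hnorm_pos _ (shift L mu x)); nra.
Qed.

Lemma simple_injective x :
  HX D phi x -> shift L lam x = vzero -> x = vzero.
Proof.
  destruct Heig as (_ & _ & Hphi & Hsimple & _).
  intros [Dx Ex] E; apply vsub_zero_eq in E.
  destruct (Hsimple x Dx E) as [c ->].
  rewrite inner_scal, <- hnorm_sq, Hphi in Ex.
  replace c with 0 by lra; hvec.
Qed.

Lemma eigenvalue_regular_HX :
  onto (HX D phi) (HY phi) (shift L lam) /\
  exists c, 0 < c /\ bounded_below (HX D phi) (shift L lam) c.
Proof.
  destruct Heig as (_ & _ & _ & _ & eps & Heps & Hiso).
  assert (Hres : forall nu, 0 < Rabs nu < eps ->
    onto (HX D phi) (HY phi) (shift (shift L lam) nu) /\
    exists c, 0 < c /\ bounded_below (HX D phi) (shift (shift L lam) nu) c).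
  { intros nu Hnu.
    assert (Hne : lam + nu <> lam)
      by (intros E; replace nu with 0 in Hnu by lra; rewrite Rabs_R0 in Hnu; lra).
    assert (Hr : in_resolvent D L (lam + nu)).
    { apply NNPP; intros Hs; apply Hne, Hiso; [|exact Hs].
      replace (lam + nu - lam) with nu by ring; apply Hnu. }
    destruct (resolvent_HX _ Hne Hr) as [H1 (c & Hc & H2)]; split.
    - intros y Hy; destruct (H1 y Hy) as (x & Hx & E); exists x.
      rewrite shift_shift; split; assumption.
    - exists c; split; [exact Hc|]; intros x Hx; rewrite shift_shift; apply H2, Hx. }
  assert (HXY : forall x, HX D phi x -> HY phi x) by (intros x Hx; apply Hx).
  split; [|exists (eps / 2); split; [lra|]].
  - apply (isolated_onto Y (HX D phi) (HY phi) (shift L lam) eps); auto using subspace_HX,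
      closed_on_HX, simple_injective, linear_on_shift, linear_on_HX, symmetric_on_shift,
      symmetric_on_HX.
  - apply (isolated_bounded_below Y (HX D phi) (HY phi) (shift L lam) eps);
      auto using subspace_HX, closed_on_HX, simple_injective, linear_on_shift, linear_on_HX,
      symmetric_on_shift, symmetric_on_HX.
Qed.

Lemma spectral_gap n : 0 <= n ->
  (forall mu, - n <= mu <= n -> (in_spectrum D L mu <-> mu = lam)) ->
  onto (HX D phi) (HY phi) L /\ exists m, n < m /\ bounded_below (HX D phi) L m.
Proof.
  intros Hn Hspec.
  assert (Hreg : forall mu, - n <= mu <= n ->
    onto (HX D phi) (HY phi) (shift L mu) /\
    exists c, 0 < c /\ bounded_below (HX D phi) (shift L mu) c).
  { intros mu Hmu; destruct (Req_dec mu lam) as [->|Hne]; [apply eigenvalue_regular_HX|].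
    apply resolvent_HX; [exact Hne|].
    apply NNPP; intros Hs; apply Hne, Hspec; assumption. }
  assert (Honto : onto (HX D phi) (HY phi) L).
  { intros y Hy; destruct (proj1 (Hreg 0 ltac:(lra)) y Hy) as (x & Hx & E).
    exists x; split; [exact Hx|]; rewrite <- E; unfold shift; hvec. }
  split; [exact Honto|].
  apply symmetric_gap; auto using subspace_HX, linear_on_HX, symmetric_on_HX.
  - intros x Hx; apply Honto, Hx.
  - intros nu Hnu; apply Hreg, Hnu.
Qed.

(** The projection kills [L (t phi) = t lam phi] and fixes [L w], which already lies in [H_Y]. So
    [PF_t] is [L] perturbed by [PN_t]. *)
Lemma PF_HX N t w : HX D phi w ->
  PF L N phi t w = vsub (L w) (Pproj phi (N (vadd w (vscal t phi)))).
Proof.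
  intros Hw; pose proof (L_HX_HY w Hw) as HLw; unfold HY in HLw.
  destruct HL as (HD & _ & [La Ls] & _); destruct Heig as (Dphi & Ephi & Hphi & _).
  assert (Ipp : inner phi phi = 1) by (rewrite <- hnorm_sq, Hphi; ring).
  unfold PF; rewrite La by (apply Hw || (apply HD; exact Dphi)).
  rewrite Ls, Ephi by exact Dphi.
  set (v := N _); unfold Pproj; inner_expand; rewrite HLw, Ipp; hvec.
Qed.

Lemma Pproj_HY y : HY phi (Pproj phi y).
Proof.
  destruct Heig as (_ & _ & Hphi & _).
  assert (Ipp : inner phi phi = 1) by (rewrite <- hnorm_sq, Hphi; ring).
  unfold HY, Pproj; inner_expand; rewrite Ipp; ring.
Qed.

Lemma hnorm_Pproj y : hnorm (Pproj phi y) <= hnorm y.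
Proof.
  destruct Heig as (_ & _ & Hphi & _).
  assert (Ipp : inner phi phi = 1) by (rewrite <- hnorm_sq, Hphi; ring).
  apply Rsqr_incr_0_var; [|apply hnorm_pos]; unfold Rsqr.
  rewrite !hnorm_sq; unfold Pproj; inner_expand; rewrite Ipp, (inner_sym _ phi y); nra.
Qed.

End SpectralGap.

(** * Differential calculus in seminormed spaces *)

Section NormFacts.
Variable X : SNSpace.
Implicit Types x y z : X.

Lemma norm_zero : norm (zero : X) = 0.
Proof.
  pose proof (norm_scal X 0 zero) as H; rewrite scal_0, Rabs_R0 in H.
  pose proof (norm_pos X zero); lra.
Qed.

Lemma norm_le_add_sub x y : norm x <= norm y + norm (sub x y).
Proof. replace x with (add y (sub x y)) at 1 by nvec; apply norm_triang. Qed.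

End NormFacts.

(** The bound is existential rather than a field of data, so that operators with the same values are
    equal ([Lin_ext]). *)
Record Lin (X Z : SNSpace) := {
  lfun :> X -> Z;
  lin_add : forall x y, lfun (add x y) = add (lfun x) (lfun y);
  lin_scal : forall a x, lfun (scal a x) = scal a (lfun x);
  lin_bdd : exists C, 0 <= C /\ forall x, norm (lfun x) <= C * norm x
}.

Arguments lfun {_ _}. Arguments lin_add {_ _}. Arguments lin_scal {_ _}. Arguments lin_bdd {_ _}.

Section OperatorNorm.
Variables X Z : SNSpace.
Implicit Types l m : Lin X Z.

Lemma Lin_ext l m : (forall x, l x = m x) -> l = m.
Proof.
  destruct l as [f fa fs fb], m as [g ga gs gb]; cbn; intros H.
  assert (E : f = g) by (apply functional_extensionality, H); subst g.
  f_equal; apply proof_irrelevance.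
Qed.

Lemma lin_sub l x y : l (sub x y) = sub (l x) (l y).
Proof. unfold sub; rewrite lin_add, lin_scal; reflexivity. Qed.

(* The operator norm is minus the supremum of the numbers [-C], [C] a bound of [l]. *)
Lemma onorm_ex l : {N : R | is_lub (fun r => r <= 0 /\ forall x, norm (l x) <= - r * norm x) N}.
Proof.
  apply completeness.
  - exists 0; intros r [Hr _]; exact Hr.
  - destruct (lin_bdd l) as (C & HC & H); exists (- C).
    split; [lra|]; rewrite Ropp_involutive; exact H.
Qed.

Definition onorm l : R := - proj1_sig (onorm_ex l).

Lemma onorm_le l C : 0 <= C -> (forall x, norm (l x) <= C * norm x) -> onorm l <= C.
Proof.
  unfold onorm; destruct (onorm_ex l) as [N [Hub Hlub]]; cbn; intros HC H.
  enough (- C <= N) by lra; apply Hub; split; [lra|]; rewrite Ropp_involutive; exact H.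
Qed.

Lemma onorm_pos l : 0 <= onorm l.
Proof.
  unfold onorm; destruct (onorm_ex l) as [N [Hub Hlub]]; cbn.
  enough (N <= 0) by lra; apply Hlub; intros r [Hr _]; exact Hr.
Qed.

Lemma onorm_bound l x : norm (l x) <= onorm l * norm x.
Proof.
  unfold onorm; destruct (onorm_ex l) as [N [Hub Hlub]]; cbn.
  (* For a seminorm [norm x = 0] does not make [x] zero; there, any bound of [l] forces
     [norm (l x) <= 0]. *)
  destruct (Req_dec (norm x) 0) as [E|E].
  - destruct (lin_bdd l) as (C & HC & H); specialize (H x); rewrite E in *; lra.
  - pose proof (norm_pos X x).
    assert (HN : N <= - (norm (l x) / norm x)).
    { apply Hlub; intros r [_ Hr]; specialize (Hr x).
      enough (norm (l x) / norm x <= - r) by lra.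
      apply Rmult_le_reg_r with (norm x); [lra|].
      unfold Rdiv; rewrite Rmult_assoc, Rinv_l; lra. }
    apply Rle_trans with (norm (l x) / norm x * norm x); [right; field; exact E|].
    apply Rmult_le_compat_r; lra.
Qed.

Lemma Lin_add_bdd l m : exists C, 0 <= C /\ forall x, norm (add (l x) (m x)) <= C * norm x.
Proof.
  exists (onorm l + onorm m).
  split; [pose proof (onorm_pos l); pose proof (onorm_pos m); lra|]; intros x.
  eapply Rle_trans; [apply norm_triang|].
  pose proof (onorm_bound l x); pose proof (onorm_bound m x); lra.
Qed.

Definition Lin_add l m : Lin X Z.
Proof.
  refine {| lfun := fun x => add (l x) (m x); lin_bdd := Lin_add_bdd l m |}.
  - intros x y; rewrite !lin_add; nvec.
  - intros a x; rewrite !lin_scal; nvec.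
Defined.

Lemma Lin_scal_bdd (a : R) l : exists C, 0 <= C /\ forall x, norm (scal a (l x)) <= C * norm x.
Proof.
  exists (Rabs a * onorm l); pose proof (onorm_pos l); pose proof (Rabs_pos a).
  split; [nra|]; intros x; eapply Rle_trans; [apply norm_scal|].
  pose proof (onorm_bound l x); nra.
Qed.

Definition Lin_scal (a : R) l : Lin X Z.
Proof.
  refine {| lfun := fun x => scal a (l x); lin_bdd := Lin_scal_bdd a l |}.
  - intros x y; rewrite !lin_add; nvec.
  - intros b x; rewrite !lin_scal; nvec.
Defined.

Lemma Lin_zero_bdd : exists C, 0 <= C /\ forall x : X, norm (zero : Z) <= C * norm x.
Proof. exists 0; split; [lra|]; intros; rewrite norm_zero; lra. Qed.

Definition Lin_zero : Lin X Z.
Proof.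
  refine {| lfun := fun _ => zero; lin_bdd := Lin_zero_bdd |}; intros; nvec.
Defined.

Definition Lin_space : SNSpace.
Proof.
  refine {| ncar := Lin X Z; add := Lin_add; scal := Lin_scal; zero := Lin_zero;
            norm := onorm |};
    try (intros; apply Lin_ext; intros; cbn; nvec).
  - apply onorm_pos.
  - intros l m; pose proof (onorm_pos l); pose proof (onorm_pos m).
    apply onorm_le; [lra|]; intros x; cbn; eapply Rle_trans; [apply norm_triang|].
    pose proof (onorm_bound l x); pose proof (onorm_bound m x); lra.
  - intros a l; pose proof (onorm_pos l); pose proof (Rabs_pos a).
    apply onorm_le; [nra|]; intros x; cbn; eapply Rle_trans; [apply norm_scal|].
    pose proof (onorm_bound l x); nra.
Defined.

End OperatorNorm.
Arguments Lin_ext {_ _}. Arguments onorm_le {_ _}. Arguments onorm_bound {_ _}.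
Arguments onorm_pos {_ _}. Arguments onorm {_ _}.

Definition mkLin {X Z : SNSpace} (f : X -> Z)
  (Ha : forall x y, f (add x y) = add (f x) (f y))
  (Hs : forall a x, f (scal a x) = scal a (f x)) (C : R) (HC : 0 <= C)
  (Hb : forall x, norm (f x) <= C * norm x) : Lin X Z :=
  {| lfun := f; lin_add := Ha; lin_scal := Hs; lin_bdd := ex_intro _ C (conj HC Hb) |}.

(** Curried, so that a bilinear map is itself an operator and can be composed with others by [ocomp]
    and [compose]. *)
Definition Bil (A B Z : SNSpace) : Type := Lin A (Lin_space B Z).

Definition mkBil {A B Z : SNSpace} (f : A -> B -> Z) (C : R) (HC : 0 <= C)
  (Hal : forall x y b, f (add x y) b = add (f x b) (f y b))
  (Hsl : forall r x b, f (scal r x) b = scal r (f x b))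
  (Har : forall a x y, f a (add x y) = add (f a x) (f a y))
  (Hsr : forall r a x, f a (scal r x) = scal r (f a x))
  (Hb : forall a b, norm (f a b) <= C * norm a * norm b) : Bil A B Z.
Proof.
  refine (@mkLin A (Lin_space B Z)
    (fun a => mkLin (f a) (Har a) (fun r => Hsr r a) (C * norm a)
                (Rmult_le_pos _ _ HC (norm_pos A a)) (Hb a)) _ _ C HC _).
  - intros x y; apply Lin_ext; intros b; apply Hal.
  - intros r x; apply Lin_ext; intros b; apply Hsl.
  - intros a; apply onorm_le; [apply Rmult_le_pos; [exact HC|apply norm_pos]|apply Hb].
Defined.

Lemma bil_bound {A B Z : SNSpace} (f : Bil A B Z) a b :
  norm (f a b) <= onorm f * norm a * norm b.
Proof.
  eapply Rle_trans; [apply onorm_bound|].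
  apply Rmult_le_compat_r; [apply norm_pos|]; exact (onorm_bound f a).
Qed.

Lemma bil_add_l {A B Z : SNSpace} (f : Bil A B Z) a a' b :
  f (add a a') b = add (f a b) (f a' b).
Proof. rewrite lin_add; reflexivity. Qed.

Lemma bil_scal_l {A B Z : SNSpace} (f : Bil A B Z) r a b :
  f (scal r a) b = scal r (f a b).
Proof. rewrite lin_scal; reflexivity. Qed.

Definition flip {A B Z : SNSpace} (f : Bil A B Z) : Bil B A Z.
Proof.
  refine (mkBil (fun b a => f a b) (onorm f) (onorm_pos f) _ _ _ _ _); intros.
  - apply lin_add.
  - apply lin_scal.
  - apply bil_add_l.
  - apply bil_scal_l.
  - pose proof (bil_bound f b a); lra.
Defined.

Definition ocomp {A B Z : SNSpace} (l : Lin B Z) (m : Lin A B) : Lin A Z.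
Proof.
  refine (mkLin (fun x => l (m x)) _ _ (onorm l * onorm m) _ _).
  - intros; rewrite !lin_add; reflexivity.
  - intros; rewrite !lin_scal; reflexivity.
  - apply Rmult_le_pos; apply onorm_pos.
  - intros x; eapply Rle_trans; [apply onorm_bound|].
    rewrite Rmult_assoc; apply Rmult_le_compat_l; [apply onorm_pos|apply onorm_bound].
Defined.

Lemma norm_ocomp {A B Z : SNSpace} (l : Lin B Z) (m : Lin A B) :
  onorm (ocomp l m) <= onorm l * onorm m.
Proof.
  apply onorm_le; [apply Rmult_le_pos; apply onorm_pos|].
  intros x; eapply Rle_trans; [exact (onorm_bound l (m x))|].
  rewrite Rmult_assoc; apply Rmult_le_compat_l; [apply onorm_pos|apply onorm_bound].
Qed.

(** As a bounded bilinear map, composition of operators falls under the product rule; this is what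
    differentiates [f' (g x) o g' x]. *)
Definition compose {A B Z : SNSpace} : Bil (Lin_space B Z) (Lin_space A B) (Lin_space A Z).
Proof.
  refine (@mkBil (Lin_space B Z) (Lin_space A B) (Lin_space A Z)
            (fun l m => ocomp l m) 1 Rle_0_1 _ _ _ _ _); intros.
  - apply Lin_ext; reflexivity.
  - apply Lin_ext; reflexivity.
  - apply Lin_ext; intros u; cbn; apply lin_add.
  - apply Lin_ext; intros u; cbn; apply lin_scal.
  - rewrite Rmult_1_l; apply norm_ocomp.
Defined.

Definition scaling {X : SNSpace} (r : R) : Lin X X.
Proof.
  refine (mkLin (fun x => scal r x) _ _ (Rabs r) (Rabs_pos r) (norm_scal X r));
    intros; nvec.
Defined.

(** * Derivatives, classes of differentiability and their rules *)

Definition continuous_map {X Z : SNSpace} (f : X -> Z) : Prop :=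
  forall x eps, 0 < eps -> exists delta, 0 < delta /\
    forall y, norm (sub y x) < delta -> norm (sub (f y) (f x)) <= eps.

Definition has_derivative {X Z : SNSpace} (f : X -> Z) (x : X) (l : Lin X Z) : Prop :=
  forall eps, 0 < eps -> exists delta, 0 < delta /\
    forall v, norm v < delta -> norm (sub (sub (f (add x v)) (f x)) (l v)) <= eps * norm v.

(** The derivative takes values in an operator space, again an [SNSpace], so higher orders arise by
    recursion without multilinear maps. *)
Fixpoint smooth (k : nat) {X Z : SNSpace} (f : X -> Z) : Prop :=
  match k with
  | O => continuous_map f
  | S j => exists f' : X -> Lin_space X Z,
             (forall x, has_derivative f x (f' x)) /\ smooth j f'
  end.

Section Derivatives.
Context {X Z : SNSpace}.

Lemma derivative_local_lipschitz (f : X -> Z) x l : has_derivative f x l ->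
  exists delta, 0 < delta /\ forall v, norm v < delta ->
    norm (sub (f (add x v)) (f x)) <= (onorm l + 1) * norm v.
Proof.
  intros H; destruct (H 1 Rlt_0_1) as (d & Hd & Hv).
  exists d; split; [exact Hd|]; intros v Hvd; specialize (Hv v Hvd).
  pose proof (norm_le_add_sub Z (sub (f (add x v)) (f x)) (l v)) as A.
  pose proof (onorm_bound l v); lra.
Qed.

Lemma derivative_continuous (f : X -> Z) (f' : X -> Lin X Z) :
  (forall x, has_derivative f x (f' x)) -> continuous_map f.
Proof.
  intros H x eps He.
  destruct (derivative_local_lipschitz f x _ (H x)) as (d & Hd & Hv).
  pose proof (onorm_pos (f' x)) as P.
  exists (Rmin d (eps / (onorm (f' x) + 1))); split.
  - apply Rmin_glb_lt; [exact Hd|apply Rdiv_lt_0_compat; lra].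
  - intros y Hy.
    pose proof (Rmin_l d (eps / (onorm (f' x) + 1))).
    pose proof (Rmin_r d (eps / (onorm (f' x) + 1))).
    specialize (Hv (sub y x)); replace (add x (sub y x)) with y in Hv by nvec.
    eapply Rle_trans; [apply Hv; lra|].
    assert (E : eps = (onorm (f' x) + 1) * (eps / (onorm (f' x) + 1))) by (field; lra).
    rewrite E; apply Rmult_le_compat_l; lra.
Qed.

Lemma smooth_continuous k (f : X -> Z) : smooth k f -> continuous_map f.
Proof.
  destruct k as [|k]; [trivial|]; intros (f' & Hf & _).
  exact (derivative_continuous f f' Hf).
Qed.

End Derivatives.

Lemma smooth_le k j {X Z : SNSpace} (f : X -> Z) : (j <= k)%nat -> smooth k f -> smooth j f.
Proof.
  revert k X Z f; induction j as [|j IH]; intros k X Z f Hjk H.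
  - exact (smooth_continuous k f H).
  - destruct k as [|k]; [lia|]; destruct H as (f' & Hf & H).
    exists f'; split; [exact Hf|]; apply (IH k); [lia|exact H].
Qed.

Lemma smooth_ext k {X Z : SNSpace} (f g : X -> Z) :
  (forall x, f x = g x) -> smooth k f -> smooth k g.
Proof. intros H; replace g with f; [trivial|]; apply functional_extensionality, H. Qed.

Lemma smooth_const k {X Z : SNSpace} (c : Z) : smooth k (fun _ : X => c).
Proof.
  revert Z c; induction k as [|k IH]; intros Z c.
  - intros x eps He; exists 1; split; [lra|]; intros.
    replace (sub c c) with (zero : Z) by nvec; rewrite norm_zero; lra.
  - exists (fun _ => (zero : Lin_space X Z)); split; [|apply IH].
    intros x eps He; exists 1; split; [lra|]; intros v _; cbn.
    replace (sub (sub c c) zero) with (zero : Z) by nvec; rewrite norm_zero.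
    pose proof (norm_pos X v); nra.
Qed.

Lemma lin_has_derivative {X Z : SNSpace} (l : Lin X Z) (f : X -> Z) c x :
  (forall y, f y = add (l y) c) -> has_derivative f x l.
Proof.
  intros E eps He; exists 1; split; [lra|]; intros v _.
  rewrite !E, lin_add.
  replace (sub _ _) with (zero : Z) by nvec; rewrite norm_zero.
  pose proof (norm_pos X v); nra.
Qed.

Lemma smooth_affine k {X Z : SNSpace} (l : Lin X Z) c : smooth k (fun x => add (l x) c).
Proof.
  destruct k as [|k].
  - exact (derivative_continuous (fun x => add (l x) c) (fun _ => l)
             (fun x => lin_has_derivative l _ c x (fun _ => eq_refl))).
  - exists (fun _ => l); split; [|apply smooth_const].
    intros x; apply lin_has_derivative with c; reflexivity.
Qed.

(** The derivative is [f'] followed by the fixed operator [compose l]: the same situation with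
    another codomain, which the induction allows. *)
Lemma smooth_post k {X Z W : SNSpace} (l : Lin Z W) (f : X -> Z) :
  smooth k f -> smooth k (fun x => l (f x)).
Proof.
  revert Z W l f; induction k as [|k IH]; intros Z W l f.
  - intros H x eps He; pose proof (onorm_pos l) as P.
    destruct (H x (eps / (onorm l + 1))) as (d & Hd & Hy); [apply Rdiv_lt_0_compat; lra|].
    exists d; split; [exact Hd|]; intros y Hyd; rewrite <- lin_sub.
    eapply Rle_trans; [apply onorm_bound|]; specialize (Hy y Hyd).
    assert (E : eps = (onorm l + 1) * (eps / (onorm l + 1))) by (field; lra).
    pose proof (norm_pos Z (sub (f y) (f x))); nra.
  - intros (f' & Hf & Hf').
    exists (fun x => compose (l : Lin_space Z W) (f' x)); split.
    + intros x eps He; pose proof (onorm_pos l) as P.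
      destruct (Hf x (eps / (onorm l + 1))) as (d & Hd & Hv); [apply Rdiv_lt_0_compat; lra|].
      exists d; split; [exact Hd|]; intros v Hvd; cbn; rewrite <- !lin_sub.
      eapply Rle_trans; [apply onorm_bound|]; specialize (Hv v Hvd).
      set (q := eps / (onorm l + 1)) in *.
      assert (E : eps = (onorm l + 1) * q) by (unfold q; field; lra).
      set (N := norm (sub _ _)) in *; assert (0 <= N) by apply norm_pos.
      rewrite E, Rmult_assoc; apply Rmult_le_compat; lra.
    + apply (IH _ _ (compose (l : Lin_space Z W)) f' Hf').
Qed.

Lemma smooth_add k {X Z : SNSpace} (f g : X -> Z) :
  smooth k f -> smooth k g -> smooth k (fun x => add (f x) (g x)).
Proof.
  revert Z f g; induction k as [|k IH]; intros Z f g.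
  - intros Hf Hg x eps He.
    destruct (Hf x (eps / 2)) as (d1 & Hd1 & H1); [lra|].
    destruct (Hg x (eps / 2)) as (d2 & Hd2 & H2); [lra|].
    exists (Rmin d1 d2); split; [apply Rmin_glb_lt; assumption|]; intros y Hy.
    pose proof (Rmin_l d1 d2); pose proof (Rmin_r d1 d2).
    replace (sub _ _) with (add (sub (f y) (f x)) (sub (g y) (g x))) by nvec.
    eapply Rle_trans; [apply norm_triang|].
    specialize (H1 y ltac:(lra)); specialize (H2 y ltac:(lra)); lra.
  - intros (f' & Hf & Hf') (g' & Hg & Hg').
    exists (fun x => add (f' x) (g' x)); split; [|apply IH; assumption].
    intros x eps He.
    destruct (Hf x (eps / 2)) as (d1 & Hd1 & H1); [lra|].
    destruct (Hg x (eps / 2)) as (d2 & Hd2 & H2); [lra|].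
    exists (Rmin d1 d2); split; [apply Rmin_glb_lt; assumption|]; intros v Hv.
    pose proof (Rmin_l d1 d2); pose proof (Rmin_r d1 d2); cbn.
    replace (sub _ _) with (add (sub (sub (f (add x v)) (f x)) (lfun (f' x) v))
                                (sub (sub (g (add x v)) (g x)) (lfun (g' x) v))) by nvec.
    eapply Rle_trans; [apply norm_triang|].
    specialize (H1 v ltac:(lra)); specialize (H2 v ltac:(lra)); lra.
Qed.

(** With increments [da] and [db], the error is [f (da - a' v) b + f a (db - b' v) + f da db]. The
    first two terms are small by differentiability, the last is quadratic in [v]. *)
Lemma bil_has_derivative {X A B Z : SNSpace} (f : Bil A B Z) (a : X -> A) (b : X -> B)
  x (a' : Lin X A) (b' : Lin X B) (l : Lin X Z) :
  has_derivative a x a' -> has_derivative b x b' ->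
  (forall v, l v = add (f (a' v) (b x)) (f (a x) (b' v))) ->
  has_derivative (fun y => f (a y) (b y)) x l.
Proof.
  intros Ha Hb El eps He.
  destruct (derivative_local_lipschitz a x a' Ha) as (d1 & Hd1 & L1).
  destruct (derivative_local_lipschitz b x b' Hb) as (d2 & Hd2 & L2).
  set (F := onorm f) in *; set (Ka := onorm a' + 1) in *; set (Kb := onorm b' + 1) in *.
  assert (HF : 0 <= F) by apply onorm_pos.
  assert (HKa : 1 <= Ka) by (pose proof (onorm_pos a'); unfold Ka; lra).
  assert (HKb : 1 <= Kb) by (pose proof (onorm_pos b'); unfold Kb; lra).
  pose proof (norm_pos A (a x)) as Na; pose proof (norm_pos B (b x)) as Nb.
  (* The three error terms have coefficients [F |b x|], [F |a x|] and [F Ka Kb] against [e |v|]; in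
     the last, one factor [|v|] is bounded by [e]. *)
  set (Q := F * (norm (a x) + norm (b x) + Ka * Kb) + 1).
  assert (HQ : 0 < Q).
  { unfold Q; assert (0 <= Ka * Kb) by nra.
    assert (0 <= F * (norm (a x) + norm (b x) + Ka * Kb)) by (apply Rmult_le_pos; lra); lra. }
  set (e := eps / Q); assert (He' : 0 < e) by (apply Rdiv_lt_0_compat; lra).
  destruct (Ha e He') as (d3 & Hd3 & L3); destruct (Hb e He') as (d4 & Hd4 & L4).
  exists (Rmin (Rmin d1 d2) (Rmin e (Rmin d3 d4))); split.
  { repeat apply Rmin_glb_lt; assumption. }
  intros v Hv.
  apply Rmin_Rgt in Hv; destruct Hv as [Hv1 Hv2].
  apply Rmin_Rgt in Hv1; destruct Hv1 as [V1 V2].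
  apply Rmin_Rgt in Hv2; destruct Hv2 as [V5 Hv2].
  apply Rmin_Rgt in Hv2; destruct Hv2 as [V3 V4].
  specialize (L1 v V1); specialize (L2 v V2); specialize (L3 v V3); specialize (L4 v V4).
  pose proof (norm_pos X v) as Nv.
  set (da := sub (a (add x v)) (a x)) in *; set (db := sub (b (add x v)) (b x)) in *.
  replace (sub _ _) with
    (add (add (f (sub da (a' v)) (b x)) (f (a x) (sub db (b' v)))) (f da db)).
  2:{ rewrite El; unfold da, db, sub.
      rewrite !bil_add_l, !bil_scal_l, !lin_add, !lin_scal; nvec. }
  eapply Rle_trans; [apply norm_triang|].
  pose proof (norm_triang Z (f (sub da (a' v)) (b x)) (f (a x) (sub db (b' v)))) as T1.
  pose proof (bil_bound f (sub da (a' v)) (b x)) as B1.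
  pose proof (bil_bound f (a x) (sub db (b' v))) as B2.
  pose proof (bil_bound f da db) as B3.
  fold F in B1, B2, B3.
  pose proof (norm_pos A (sub da (a' v))) as P1; pose proof (norm_pos B (sub db (b' v))) as P2.
  pose proof (norm_pos A da) as P3; pose proof (norm_pos B db) as P4.
  set (nv := norm v) in *.
  assert (C1 : F * norm (sub da (a' v)) * norm (b x) <= F * (e * nv) * norm (b x))
    by (apply Rmult_le_compat_r; [lra|apply Rmult_le_compat_l; lra]).
  assert (C2 : F * norm (a x) * norm (sub db (b' v)) <= F * norm (a x) * (e * nv))
    by (apply Rmult_le_compat_l; [nra|lra]).
  assert (C3 : F * norm da * norm db <= F * (Ka * nv) * (Kb * e)).
  { apply Rmult_le_compat; [nra|lra|apply Rmult_le_compat_l; lra|nra]. }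
  assert (E : eps = Q * e) by (unfold e; field; lra).
  assert (0 <= e * nv) by nra.
  apply Rle_trans with (F * (norm (a x) + norm (b x) + Ka * Kb) * (e * nv)); [nra|].
  rewrite E; unfold Q; nra.
Qed.

Lemma smooth_bil k {X A B Z : SNSpace} (f : Bil A B Z) (a : X -> A) (b : X -> B) :
  smooth k a -> smooth k b -> smooth k (fun x => f (a x) (b x)).
Proof.
  revert A B Z f a b; induction k as [|k IH]; intros A B Z f a b.
  - intros Ha Hb x eps He.
    set (F := onorm f); assert (HF : 0 <= F) by apply onorm_pos.
    pose proof (norm_pos A (a x)) as Na; pose proof (norm_pos B (b x)) as Nb.
    set (Q := F * (norm (a x) + norm (b x) + 1) + 1).
    assert (HQ : 0 < Q) by (unfold Q; nra).
    set (e := Rmin 1 (eps / Q)).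
    assert (He' : 0 < e) by (apply Rmin_glb_lt; [lra|apply Rdiv_lt_0_compat; lra]).
    assert (He1 : e <= 1) by apply Rmin_l.
    assert (He2 : Q * e <= eps).
    { apply Rle_trans with (Q * (eps / Q)); [apply Rmult_le_compat_l; [lra|apply Rmin_r]|].
      right; field; lra. }
    destruct (Ha x e He') as (d1 & Hd1 & H1); destruct (Hb x e He') as (d2 & Hd2 & H2).
    exists (Rmin d1 d2); split; [apply Rmin_glb_lt; assumption|]; intros y Hy.
    pose proof (Rmin_l d1 d2); pose proof (Rmin_r d1 d2).
    specialize (H1 y ltac:(lra)); specialize (H2 y ltac:(lra)).
    set (da := sub (a y) (a x)) in *; set (db := sub (b y) (b x)) in *.
    replace (sub _ _) with (add (add (f da (b x)) (f (a x) db)) (f da db)).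
    2:{ unfold da, db, sub.
        rewrite !bil_add_l, !bil_scal_l, !lin_add, !lin_scal; nvec. }
    eapply Rle_trans; [apply norm_triang|].
    pose proof (norm_triang Z (f da (b x)) (f (a x) db)) as T1.
    pose proof (bil_bound f da (b x)) as B1.
    pose proof (bil_bound f (a x) db) as B2.
    pose proof (bil_bound f da db) as B3.
    fold F in B1, B2, B3.
    pose proof (norm_pos A da) as P3; pose proof (norm_pos B db) as P4.
    assert (C1 : F * norm da * norm (b x) <= F * e * norm (b x))
      by (apply Rmult_le_compat_r; [lra|apply Rmult_le_compat_l; lra]).
    assert (C2 : F * norm (a x) * norm db <= F * norm (a x) * e)
      by (apply Rmult_le_compat_l; [nra|lra]).
    assert (C3 : F * norm da * norm db <= F * e * 1).
    { apply Rmult_le_compat; [nra|lra|apply Rmult_le_compat_l; lra|lra]. }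
    unfold Q in He2; nra.
  - intros Ha Hb.
    pose proof (smooth_le (S k) k a ltac:(lia) Ha) as Ha0.
    pose proof (smooth_le (S k) k b ltac:(lia) Hb) as Hb0.
    destruct Ha as (a' & Ha & Ha'), Hb as (b' & Hb & Hb').
    (* [f1] sends [(l, b)] to [v |-> f (l v) b], and [f2] sends [(a, l)] to [v |-> f a (l v)]. Both
       terms of the product rule are thus bilinear in maps of class [k], and the induction
       hypothesis applies to them. *)
    pose (f1 := flip (ocomp (@compose X A Z) (flip f)) : Bil (Lin_space X A) B (Lin_space X Z)).
    pose (f2 := ocomp (@compose X B Z) f : Bil A (Lin_space X B) (Lin_space X Z)).
    exists (fun x => add (f1 (a' x) (b x)) (f2 (a x) (b' x))); split.
    + intros x; apply bil_has_derivative with (a' := a' x) (b' := b' x); auto.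
    + apply smooth_add; apply IH; assumption.
Qed.

Lemma chain_rule {X Z W : SNSpace} (f : Z -> W) (g : X -> Z) x (f' : Lin Z W) (g' : Lin X Z) :
  has_derivative f (g x) f' -> has_derivative g x g' ->
  has_derivative (fun y => f (g y)) x (ocomp f' g').
Proof.
  intros Hf Hg eps He.
  destruct (derivative_local_lipschitz g x g' Hg) as (d1 & Hd1 & L1).
  set (K := onorm g' + 1) in *; set (M := onorm f' + 1) in *.
  assert (HK : 1 <= K) by (pose proof (onorm_pos g'); unfold K; lra).
  assert (HM : 1 <= M) by (pose proof (onorm_pos f'); unfold M; lra).
  (* Half of [eps] pays for the error of [f] at the increment of [g], of size at most [K |v|]; the
     other half pays for the error of [g] magnified by [f']. *)
  destruct (Hf (eps / (2 * K))) as (d2 & Hd2 & L2); [apply Rdiv_lt_0_compat; lra|].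
  destruct (Hg (eps / (2 * M))) as (d3 & Hd3 & L3); [apply Rdiv_lt_0_compat; lra|].
  exists (Rmin d1 (Rmin (d2 / K) d3)); split.
  { repeat apply Rmin_glb_lt; trivial; apply Rdiv_lt_0_compat; lra. }
  intros v Hv.
  apply Rmin_Rgt in Hv; destruct Hv as [V1 Hv].
  apply Rmin_Rgt in Hv; destruct Hv as [V2 V3].
  specialize (L1 v V1); specialize (L3 v V3); pose proof (norm_pos X v) as Nv.
  set (dg := sub (g (add x v)) (g x)) in *.
  assert (Hdg : norm dg < d2).
  { eapply Rle_lt_trans; [exact L1|].
    replace d2 with (K * (d2 / K)) by (field; lra); apply Rmult_lt_compat_l; lra. }
  specialize (L2 dg Hdg); replace (add (g x) dg) with (g (add x v)) in L2 by (unfold dg; nvec).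
  replace (sub _ _) with
    (add (sub (sub (f (g (add x v))) (f (g x))) (f' dg)) (f' (sub dg (g' v))))
    by (rewrite lin_sub; cbn; nvec).
  eapply Rle_trans; [apply norm_triang|].
  pose proof (onorm_bound f' (sub dg (g' v))) as B.
  pose proof (norm_pos Z (sub dg (g' v))) as P.
  assert (C1 : eps / (2 * K) * norm dg <= eps / (2 * K) * (K * norm v)).
  { apply Rmult_le_compat_l; [left; apply Rdiv_lt_0_compat; lra|exact L1]. }
  assert (C2 : onorm f' * norm (sub dg (g' v)) <= M * (eps / (2 * M) * norm v)).
  { apply Rmult_le_compat; [apply onorm_pos|exact P|unfold M; lra|exact L3]. }
  replace (eps / (2 * K) * (K * norm v)) with (eps / 2 * norm v) in C1 by (field; lra).
  replace (M * (eps / (2 * M) * norm v)) with (eps / 2 * norm v) in C2 by (field; lra).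
  lra.
Qed.

Lemma smooth_comp k {X Z W : SNSpace} (f : Z -> W) (g : X -> Z) :
  smooth k f -> smooth k g -> smooth k (fun x => f (g x)).
Proof.
  revert W f; induction k as [|k IH]; intros W f Hf Hg.
  - intros x eps He; destruct (Hf (g x) eps He) as (d1 & Hd1 & H1).
    destruct (Hg x (d1 / 2)) as (d2 & Hd2 & H2); [lra|].
    exists d2; split; [exact Hd2|]; intros y Hy; apply H1; specialize (H2 y Hy); lra.
  - pose proof (smooth_le (S k) k g ltac:(lia) Hg) as Hg0.
    destruct Hf as (f' & Hf & Hf'), Hg as (g' & Hg & Hg').
    exists (fun x => compose (f' (g x)) (g' x)); split.
    + intros x; exact (chain_rule f g x (f' (g x)) (g' x) (Hf (g x)) (Hg x)).
    + apply (smooth_bil k compose (fun x => f' (g x)) g'); [apply IH; assumption|assumption].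
Qed.

(** * Smoothness of operator inversion *)

Section InverseOperators.
Variables U X Z : SNSpace.
Variable H : U -> Lin_space X Z.
Variable J : U -> Lin_space Z X.
Variable c : R.
Hypothesis HJ : forall u, norm (J u) <= c.
Hypothesis HHJ : forall u z, lfun (H u) (lfun (J u) z) = z.
Hypothesis HJH : forall u x, lfun (J u) (lfun (H u) x) = x.

Lemma inverse_bound_pos (u : U) : 0 <= c.
Proof. eapply Rle_trans; [apply (norm_pos _ (J u))|apply HJ]. Qed.

(** The resolvent identity [J v - J u = - J v (H v - H u) J u]. *)
Lemma inverse_difference u v z :
  lfun (sub (J v) (J u)) z = scal (-1) (lfun (J v) (lfun (sub (H v) (H u)) (lfun (J u) z))).
Proof.
  cbn; rewrite lin_add, HJH, lin_scal, HHJ; nvec.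
Qed.

Lemma inverse_lipschitz u v : norm (sub (J v) (J u)) <= c * c * norm (sub (H v) (H u)).
Proof.
  pose proof (inverse_bound_pos u) as Hc.
  pose proof (norm_pos _ (sub (H v) (H u))) as P.
  apply onorm_le; [nra|]; intros z; rewrite inverse_difference.
  eapply Rle_trans; [apply norm_scal|]; rewrite Rabs_left by lra.
  pose proof (onorm_bound (J v) (lfun (sub (H v) (H u)) (lfun (J u) z))) as B1.
  pose proof (onorm_bound (sub (H v) (H u) : Lin_space X Z) (lfun (J u) z)) as B2.
  pose proof (onorm_bound (J u) z) as B3.
  pose proof (HJ u) as Cu; pose proof (HJ v) as Cv; cbn in Cu, Cv.
  pose proof (norm_pos _ z) as Pz.
  assert (B3' : norm (lfun (J u) z) <= c * norm z) by nra.
  change (onorm (sub (H v) (H u) : Lin_space X Z)) with (norm (sub (H v) (H u))) in B2.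
  set (h := norm (sub (H v) (H u))) in *.
  set (w := lfun (sub (H v) (H u)) (lfun (J u) z)) in *.
  assert (B2' : norm w <= h * (c * norm z)) by nra.
  pose proof (norm_pos _ w) as Pw.
  assert (onorm (J v) * norm w <= c * norm w) by (apply Rmult_le_compat_r; lra).
  assert (c * norm w <= c * (h * (c * norm z))) by (apply Rmult_le_compat_l; lra).
  lra.
Qed.

(** The map [v |-> - J u o (H'u v) o J u], assembled from [compose] and [flip] so that its
    dependence on [J u] is visibly smooth. *)
Definition inverse_derivative (u : U) (H'u : Lin U (Lin_space X Z)) : Lin U (Lin_space Z X) :=
  ocomp (scal (-1) (ocomp (compose (J u)) (flip (@compose Z X Z) (J u))
                    : Lin_space (Lin_space X Z) (Lin_space Z X))) H'u.

(** By the resolvent identity the error is [- (J R1 J + dJ dH J)], where [R1 = dH - H'u v] is the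
    error of [H]. The second term is quadratic in [v] because [dJ] is controlled by [dH]. *)
Lemma inverse_has_derivative u (H'u : Lin U (Lin_space X Z)) :
  has_derivative H u H'u -> has_derivative J u (inverse_derivative u H'u).
Proof.
  intros HH eps He; pose proof (inverse_bound_pos u) as Hc.
  destruct (derivative_local_lipschitz H u H'u HH) as (d1 & Hd1 & L1).
  set (K := onorm H'u + 1) in *.
  assert (HK : 1 <= K) by (pose proof (onorm_pos H'u); unfold K; lra).
  (* Against [e |v|], the term [J R1 J] contributes [c^2] and [dJ dH J] contributes [c^3 K^2], one
     factor [|v|] being bounded by [e]. *)
  set (Q := c * c * (1 + c * (K * K)) + 1).
  assert (HQ : 0 < Q).
  { unfold Q; assert (0 <= c * c * (1 + c * (K * K))); [|lra].
    assert (0 <= c * (K * K)) by (apply Rmult_le_pos; nra).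
    apply Rmult_le_pos; nra. }
  set (e := eps / Q); assert (He' : 0 < e) by (apply Rdiv_lt_0_compat; lra).
  destruct (HH e He') as (d2 & Hd2 & L2).
  exists (Rmin d1 (Rmin e d2)); split; [repeat apply Rmin_glb_lt; assumption|].
  intros v Hv; apply Rmin_Rgt in Hv; destruct Hv as [V1 Hv].
  apply Rmin_Rgt in Hv; destruct Hv as [V2 V3].
  specialize (L1 v V1); specialize (L2 v V3); pose proof (norm_pos U v) as Nv.
  pose proof (inverse_lipschitz u (add u v)) as LJ.
  set (dH := sub (H (add u v)) (H u)) in *; set (dJ := sub (J (add u v)) (J u)) in *.
  pose proof (norm_pos _ dH) as PH; pose proof (norm_pos _ dJ) as PJ.
  set (R1 := sub dH (H'u v)) in *.
  set (nv := norm v) in *.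
  assert (Hfinal : c * c * (e * nv) + c * c * (K * nv) * (K * nv) * c <= eps * nv).
  { assert (E : eps = Q * e) by (unfold e; field; lra).
    rewrite E; unfold Q.
    assert (c * c * (K * nv) * (K * nv) * c <= c * c * (c * (K * K)) * (e * nv)).
    2:{ assert (0 <= e * nv) by nra.
        replace ((c * c * (1 + c * (K * K)) + 1) * e * nv) with
          (c * c * (e * nv) + c * c * (c * (K * K)) * (e * nv) + e * nv) by ring; lra. }
    replace (c * c * (K * nv) * (K * nv) * c) with (c * c * (c * (K * K)) * (nv * nv)) by ring.
    apply Rmult_le_compat_l; [|nra].
    apply Rmult_le_pos; [nra|apply Rmult_le_pos; nra]. }
  eapply Rle_trans; [|exact Hfinal]; clearbody e.
  assert (P0 : 0 <= c * c * (e * nv) + c * c * (K * nv) * (K * nv) * c).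
  { apply Rplus_le_le_0_compat; repeat apply Rmult_le_pos; lra. }
  apply onorm_le; [exact P0|]; intros z.
  assert (Eq : lfun (sub dJ (inverse_derivative u H'u v)) z =
     scal (-1) (add (lfun (J u) (lfun R1 (lfun (J u) z)))
                    (lfun dJ (lfun dH (lfun (J u) z))))).
  { pose proof (inverse_difference u (add u v) z) as E1; fold dH dJ in E1.
    assert (E2 : lfun dJ (lfun dH (lfun (J u) z)) =
      sub (lfun (J (add u v)) (lfun dH (lfun (J u) z))) (lfun (J u) (lfun dH (lfun (J u) z))))
      by reflexivity.
    rewrite E2.
    assert (E3 : lfun R1 (lfun (J u) z) =
        sub (lfun dH (lfun (J u) z)) (lfun (H'u v) (lfun (J u) z))) by reflexivity.
    rewrite E3, lin_sub.
    change (lfun (sub dJ (inverse_derivative u H'u v)) z) with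
      (sub (lfun dJ z) (scal (-1) (lfun (J u) (lfun (H'u v) (lfun (J u) z))))).
    rewrite E1; nvec. }
  rewrite Eq.
  eapply Rle_trans; [apply norm_scal|]; rewrite Rabs_left by lra.
  pose proof (norm_triang X (lfun (J u) (lfun R1 (lfun (J u) z)))
                 (lfun dJ (lfun dH (lfun (J u) z)))) as T1.
  pose proof (HJ u) as Cu; cbn in Cu.
  pose proof (onorm_bound (J u) z) as B0.
  pose proof (onorm_bound (R1 : Lin X Z) (lfun (J u) z)) as B1.
  pose proof (onorm_bound (J u) (lfun R1 (lfun (J u) z))) as B2.
  pose proof (onorm_bound (dH : Lin X Z) (lfun (J u) z)) as B3.
  pose proof (onorm_bound (dJ : Lin Z X) (lfun dH (lfun (J u) z))) as B4.
  change (onorm (R1 : Lin X Z)) with (norm R1) in B1.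
  change (onorm (dH : Lin X Z)) with (norm dH) in B3.
  change (onorm (dJ : Lin Z X)) with (norm dJ) in B4.
  pose proof (norm_pos _ z) as Pz; pose proof (norm_pos _ R1) as PR.
  set (w := lfun (J u) z) in *.
  assert (Bw : norm w <= c * norm z) by nra.
  pose proof (norm_pos _ w) as Pw.
  pose proof (norm_pos _ (lfun R1 w)) as Pw1.
  pose proof (norm_pos _ (lfun dH w)) as Pw2.
  assert (C1 : norm (lfun R1 w) <= (e * nv) * (c * norm z)).
  { eapply Rle_trans; [exact B1|]; apply Rmult_le_compat; lra. }
  assert (C2 : norm (lfun (J u) (lfun R1 w)) <= c * ((e * nv) * (c * norm z))).
  { eapply Rle_trans; [exact B2|]; apply Rmult_le_compat; try lra; apply onorm_pos. }
  assert (C3 : norm (lfun dH w) <= (K * nv) * (c * norm z)).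
  { eapply Rle_trans; [exact B3|]; apply Rmult_le_compat; lra. }
  assert (C5 : norm dJ <= c * c * (K * nv)).
  { eapply Rle_trans; [exact LJ|]; apply Rmult_le_compat_l; [nra|lra]. }
  assert (C4 : norm (lfun dJ (lfun dH w)) <= (c * c * (K * nv)) * ((K * nv) * (c * norm z))).
  { eapply Rle_trans; [exact B4|]; apply Rmult_le_compat; lra. }
  lra.
Qed.

(** The derivative of [J] is a product of [J], [J] and [H']. If these are of class [k], so is the
    product, and [J] gains one order. *)
Lemma smooth_inverse_operator k : smooth k H -> smooth k J.
Proof.
  induction k as [|k IH].
  - intros HH u eps He; pose proof (inverse_bound_pos u) as Hc.
    destruct (HH u (eps / (c * c + 1))) as (d & Hd & Hy); [apply Rdiv_lt_0_compat; nra|].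
    exists d; split; [exact Hd|]; intros v Hv; specialize (Hy v Hv).
    eapply Rle_trans; [apply inverse_lipschitz|].
    set (q := eps / (c * c + 1)) in *.
    assert (E : eps = (c * c + 1) * q) by (unfold q; field; nra).
    pose proof (norm_pos _ (sub (H v) (H u))).
    rewrite E; apply Rmult_le_compat; nra.
  - intros HH; pose proof (IH (smooth_le (S k) k H ltac:(lia) HH)) as HJk.
    destruct HH as (H' & HH & HH').
    exists (fun u => inverse_derivative u (H' u)); split.
    + intros u; apply inverse_has_derivative, HH.
    + pose (P := fun u => compose (compose (J u)) (flip (@compose Z X Z) (J u))
               : Lin_space (Lin_space X Z) (Lin_space Z X)).
      assert (HP : smooth k P).
      { apply (smooth_bil k compose (fun u => compose (J u))
                 (fun u => flip (@compose Z X Z) (J u))); apply smooth_post; exact HJk. }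
      exact (smooth_bil k compose (fun u => scaling (-1) (P u)) H'
               (smooth_post k (scaling (-1)) P HP) HH').
Qed.

End InverseOperators.

(** * Smoothness of a Lipschitz inverse function *)

Section InverseFunctions.
Variables X Z : SNSpace.
Variable f : X -> Z.
Variable f' : X -> Lin_space X Z.
Variable g : Z -> X.
Variable J : Z -> Lin_space Z X.
Variable c : R.
Hypothesis Hf : forall x, has_derivative f x (f' x).
Hypothesis Hfg : forall z, f (g z) = z.
Hypothesis Hg : forall y z, norm (sub (g y) (g z)) <= c * norm (sub y z).
Hypothesis HJ : forall z, norm (J z) <= c.
Hypothesis HHJ : forall u z, lfun (f' (g u)) (lfun (J u) z) = z.
Hypothesis HJH : forall u x, lfun (J u) (lfun (f' (g u)) x) = x.

(** With [v = g (z + u) - g z], the error [v - J u] is [- J (u - f' v)]. Here [u - f' v] is the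
    error of [f] at [g z], and [|v| <= c |u|] turns [o(|v|)] into [o(|u|)]. *)
Lemma inverse_function_derivative z : has_derivative g z (J z).
Proof.
  intros eps He.
  assert (Hc : 0 <= c) by (eapply Rle_trans; [apply (norm_pos _ (J z))|apply HJ]).
  (* One factor [c] is the bound of [J], the other the Lipschitz constant of [g]; the 1 keeps the
     denominator positive. *)
  destruct (Hf (g z) (eps / (c * c + 1))) as (d & Hd & Hv); [apply Rdiv_lt_0_compat; nra|].
  exists (d / (c + 1)); split; [apply Rdiv_lt_0_compat; lra|]; intros u Hu.
  pose proof (norm_pos _ u) as Pu.
  pose proof (Hg (add z u) z) as L; replace (sub (add z u) z) with u in L by nvec.
  set (v := sub (g (add z u)) (g z)) in *.
  assert (Hvd : norm v < d).
  { apply Rle_lt_trans with ((c + 1) * norm u); [nra|].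
    replace d with ((c + 1) * (d / (c + 1))) by (field; lra).
    apply Rmult_lt_compat_l; lra. }
  specialize (Hv v Hvd).
  replace (add (g z) v) with (g (add z u)) in Hv by (unfold v; nvec).
  rewrite !Hfg in Hv; replace (sub (add z u) z) with u in Hv by nvec.
  replace (sub v (lfun (J z) u)) with
    (scal (-1) (lfun (J z) (sub u (lfun (f' (g z)) v))))
    by (rewrite lin_sub, HJH; nvec).
  eapply Rle_trans; [apply norm_scal|]; rewrite Rabs_left by lra.
  pose proof (onorm_bound (J z) (sub u (lfun (f' (g z)) v))) as B.
  pose proof (HJ z) as Cz; cbn in Cz.
  set (q := eps / (c * c + 1)) in *.
  assert (E : eps = (c * c + 1) * q) by (unfold q; field; nra).
  assert (Hq : 0 < q) by (apply Rdiv_lt_0_compat; nra).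
  set (w := sub u (lfun (f' (g z)) v)) in *; pose proof (norm_pos _ w) as Pw.
  assert (B' : norm (lfun (J z) w) <= c * (q * (c * norm u))).
  { eapply Rle_trans; [exact B|]; apply Rmult_le_compat; trivial; [apply onorm_pos|].
    eapply Rle_trans; [exact Hv|]; apply Rmult_le_compat_l; lra. }
  assert (0 <= q * norm u) by nra.
  rewrite E; lra.
Qed.

Lemma smooth_inverse_function k : smooth k f' -> smooth (S k) g.
Proof.
  intros Hf'.
  assert (Hj : forall j, (j <= S k)%nat -> smooth j g).
  { induction j as [|j IH]; intros Hjk.
    - exact (derivative_continuous g J inverse_function_derivative).
    - exists J; split; [apply inverse_function_derivative|].
      apply (smooth_inverse_operator Z X Z (fun z => f' (g z)) J c); trivial.
      apply smooth_comp; [apply (smooth_le k); [lia|exact Hf']|apply IH; lia]. }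
  apply Hj; lia.
Qed.

End InverseFunctions.

(** * Multilinear derivatives and operator-valued derivatives *)

Definition seminorm_on {Y : RHilbert} (S : Y -> Prop) (nS : Y -> R) : Prop :=
  (forall x, S x -> 0 <= nS x) /\
  (forall x y, S x -> S y -> nS (vadd x y) <= nS x + nS y) /\
  (forall a x, S x -> nS (vscal a x) <= Rabs a * nS x).

Lemma sig_eq {A : Type} (P : A -> Prop) (x y : {a | P a}) :
  proj1_sig x = proj1_sig y -> x = y.
Proof. destruct x, y; cbn; intros <-; f_equal; apply proof_irrelevance. Qed.

(** Makes a subspace given by a predicate a space in its own right, to which the calculus of total
    maps applies. *)
Definition sub_space {Y : RHilbert} (S : Y -> Prop) (nS : Y -> R)
  (HS : subspace S) (HnS : seminorm_on S nS) : SNSpace.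
Proof.
  refine {| ncar := {x : Y | S x};
    add := fun x y => exist S (vadd (proj1_sig x) (proj1_sig y))
             (proj1 (proj2 HS) _ _ (proj2_sig x) (proj2_sig y));
    scal := fun a x => exist S (vscal a (proj1_sig x))
              (proj2 (proj2 HS) a _ (proj2_sig x));
    zero := exist S vzero (proj1 HS);
    norm := fun x => nS (proj1_sig x) |};
  try (intros; apply sig_eq; cbn; hvec).
  - intros x; apply HnS, proj2_sig.
  - intros x y; apply HnS; apply proj2_sig.
  - intros a x; apply HnS, proj2_sig.
Defined.

Section Towers.
Variable Y : RHilbert.
Variables (S T : Y -> Prop) (nS nT : Y -> R).
Hypotheses (HS : subspace S) (HT : subspace T).
Hypotheses (HnS : seminorm_on S nS) (HnT : seminorm_on T nT).

Local Notation X := (sub_space S nS HS HnS).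
Local Notation Z := (sub_space T nT HT HnT).

Fixpoint Multi (p : nat) : SNSpace :=
  match p with
  | O => Z
  | Datatypes.S q => Lin_space X (Multi q)
  end.

(** Differentiation adds the outermost argument, read here from position 0; this matches [hcons] in
    [Ck], which puts the new direction first. *)
Fixpoint ev (p : nat) : Multi p -> (nat -> X) -> Z :=
  match p with
  | O => fun w _ => w
  | Datatypes.S q => fun (w : Lin X (Multi q)) h => ev q (w (h O)) (fun i => h (Datatypes.S i))
  end.

Fixpoint prod_norm (h : nat -> X) (p : nat) : R :=
  match p with
  | O => 1
  | Datatypes.S q => norm (h O) * prod_norm (fun i => h (Datatypes.S i)) q
  end.

Definition val (x : X) : Y := proj1_sig x.
Definition zval (z : Z) : Y := proj1_sig z.

Lemma val_in x : S (val x).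
Proof. exact (proj2_sig x). Qed.

(** Total, with value zero off [S], because the derivatives in [Ck] are functions of arbitrary
    sequences in [Y]. *)
Definition toX (y : Y) : X :=
  match excluded_middle_informative (S y) with
  | left H => exist S y H
  | right _ => zero
  end.

Lemma val_toX y : S y -> val (toX y) = y.
Proof. intros H; unfold toX; destruct excluded_middle_informative; [reflexivity|contradiction]. Qed.

Lemma prod_norm_pos h p : 0 <= prod_norm h p.
Proof.
  revert h; induction p as [|p IH]; intros h; cbn; [lra|].
  apply Rmult_le_pos; [apply HnS, proj2_sig|apply IH].
Qed.

(** [prodn] peels off the last factor, whereas [ev] and [prod_norm] consume the first. *)
Lemma prodn_shift (h : nat -> Y) p :
  prodn nS h (Datatypes.S p) = nS (h O) * prodn nS (fun i => h (Datatypes.S i)) p.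
Proof.
  induction p as [|p IH]; [cbn; ring|].
  change (prodn nS h (Datatypes.S p) * nS (h (Datatypes.S p)) =
          nS (h O) * (prodn nS (fun i => h (Datatypes.S i)) p * nS (h (Datatypes.S p)))).
  rewrite IH; ring.
Qed.

Lemma prod_norm_prodn (h : nat -> X) p : prod_norm h p = prodn nS (fun i => val (h i)) p.
Proof.
  revert h; induction p as [|p IH]; intros h; [reflexivity|].
  rewrite prodn_shift; cbn; rewrite IH; reflexivity.
Qed.

Lemma prodn_args (h : nat -> Y) p : args_in S h p ->
  prod_norm (fun i => toX (h i)) p = prodn nS h p.
Proof.
  intros Hh; rewrite prod_norm_prodn.
  induction p as [|p IH]; [reflexivity|]; cbn.
  rewrite IH by (intros i Hi; apply Hh; lia).
  rewrite val_toX by (apply Hh; lia); reflexivity.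
Qed.

Lemma prodn_pos (h : nat -> Y) p : args_in S h p -> 0 <= prodn nS h p.
Proof. intros Hh; rewrite <- prodn_args by exact Hh; apply prod_norm_pos. Qed.

Lemma ev_add p w w' h : ev p (add w w') h = add (ev p w h) (ev p w' h).
Proof. revert w w' h; induction p as [|p IH]; intros; [reflexivity|apply IH]. Qed.

Lemma ev_scal p a w h : ev p (scal a w) h = scal a (ev p w h).
Proof. revert w h; induction p as [|p IH]; intros; [reflexivity|apply IH]. Qed.

Lemma ev_sub p w w' h : ev p (sub w w') h = sub (ev p w h) (ev p w' h).
Proof. unfold sub; rewrite ev_add, ev_scal; reflexivity. Qed.

Lemma ev_bound p w h : norm (ev p w h) <= norm w * prod_norm h p.
Proof.
  revert w h; induction p as [|p IH]; intros w h.
  - cbn; lra.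
  - eapply Rle_trans; [apply (IH (lfun w (h O)))|].
    change (prod_norm h (Datatypes.S p)) with (norm (h O) * prod_norm (fun i => h (Datatypes.S i)) p).
    rewrite <- Rmult_assoc; apply Rmult_le_compat_r; [apply prod_norm_pos|].
    exact (onorm_bound w (h O)).
Qed.

Definition ncons (x : X) (h : nat -> X) (i : nat) : X :=
  match i with O => x | Datatypes.S j => h j end.

(** Converse of [ev_bound]: the iterated operator norm is the norm of the multilinear map, so
    estimates travel both ways between [smooth] and [Ck]. *)
Lemma ev_norm_le p w C : 0 <= C ->
  (forall h, norm (ev p w h) <= C * prod_norm h p) -> norm w <= C.
Proof.
  revert w C; induction p as [|p IH]; intros w C HC H.
  - specialize (H (fun _ => zero)); cbn in *; lra.
  - apply onorm_le; [exact HC|]; intros x.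
    apply IH; [apply Rmult_le_pos; [exact HC|apply norm_pos]|]; intros h.
    specialize (H (ncons x h)); cbn in H; cbn; rewrite Rmult_assoc; exact H.
Qed.

Lemma ev_ext p w h h' : (forall i, (i < p)%nat -> h i = h' i) -> ev p w h = ev p w h'.
Proof.
  revert w h h'; induction p as [|p IH]; intros w h h' H; [reflexivity|].
  cbn; rewrite (H O) by lia; apply IH; intros i Hi; apply H; lia.
Qed.

Lemma ev_inj p w w' : (forall h, ev p w h = ev p w' h) -> w = w'.
Proof.
  revert w w'; induction p as [|p IH]; intros w w' H.
  - exact (H (fun _ => zero)).
  - apply Lin_ext; intros x; apply IH; intros h; exact (H (ncons x h)).
Qed.

Definition nupd (h : nat -> X) (i : nat) (v : X) : nat -> X :=
  fun k => if Nat.eqb k i then v else h k.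

Lemma ev_upd p w h i a u v : (i < p)%nat ->
  ev p w (nupd h i (add (scal a u) v)) =
  add (scal a (ev p w (nupd h i u))) (ev p w (nupd h i v)).
Proof.
  revert w h i; induction p as [|p IH]; intros w h i Hi; [lia|].
  destruct i as [|i].
  - change (ev p (lfun w (add (scal a u) v)) (fun i => h (Datatypes.S i)) =
      add (scal a (ev p (lfun w u) (fun i => h (Datatypes.S i))))
          (ev p (lfun w v) (fun i => h (Datatypes.S i)))).
    rewrite lin_add, lin_scal, ev_add, ev_scal; reflexivity.
  - exact (IH (lfun w (h O)) (fun i => h (Datatypes.S i)) i ltac:(lia)).
Qed.

Definition family (p : nat) (w : Multi p) (h : nat -> Y) : Y :=
  zval (ev p w (fun i => toX (h i))).

Lemma toX_lincomb a u v : S u -> S v ->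
  toX (vadd (vscal a u) v) = add (scal a (toX u)) (toX v).
Proof.
  intros Hu Hv; apply sig_eq.
  change (val (toX (vadd (vscal a u) v)) = vadd (vscal a (val (toX u))) (val (toX v))).
  rewrite !val_toX; trivial; apply HS; [apply HS|]; assumption.
Qed.

Lemma family_multilinear p w : bounded_multilinear S nS nT p (family p w).
Proof.
  split; [|split].
  - intros h h' H; unfold family; f_equal; apply ev_ext; intros i Hi; rewrite H; trivial.
  - intros h i a u v Hi Hh Hu Hv; unfold family.
    assert (E : forall z, (fun k => toX (upd h i z k)) = nupd (fun k => toX (h k)) i (toX z))
      by (intros z; apply functional_extensionality; intros k; unfold upd, nupd;
          destruct (Nat.eqb k i); reflexivity).
    rewrite !E, toX_lincomb, ev_upd by trivial; reflexivity.
  - exists (norm w); intros h Hh; unfold family.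
    rewrite <- prodn_args by exact Hh; apply ev_bound.
Qed.

(** The clauses of [Ck] for a map that already has [p] multilinear arguments. The offset lets an
    induction on [k] pass from a map to its derivative, trading [k] for [p]. *)
Definition tower (p k : nat) (Dk : nat -> Y -> (nat -> Y) -> Y) : Prop :=
  (forall j x, (j <= k)%nat -> S x -> bounded_multilinear S nS nT (p + j) (Dk j x)) /\
  (forall j x, (j < k)%nat -> S x ->
     forall eps, 0 < eps -> exists delta, 0 < delta /\
       forall v, S v -> nS v < delta -> forall h, args_in S h (p + j) ->
         nT (vsub (vsub (Dk j (vadd x v) h) (Dk j x h)) (Dk (Datatypes.S j) x (hcons v h)))
           <= eps * nS v * prodn nS h (p + j)) /\
  (forall j x, (j <= k)%nat -> S x ->
     forall eps, 0 < eps -> exists delta, 0 < delta /\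
       forall y, S y -> nS (vsub y x) < delta -> forall h, args_in S h (p + j) ->
         nT (vsub (Dk j y h) (Dk j x h)) <= eps * prodn nS h (p + j)).

Lemma toX_sub y x : S y -> S x -> sub (toX y) (toX x) = toX (vsub y x).
Proof.
  intros Hy Hx; apply sig_eq.
  change (vadd (val (toX y)) (vscal (-1) (val (toX x))) = val (toX (vsub y x))).
  rewrite !val_toX; trivial; apply subspace_sub; trivial.
Qed.

Lemma toX_add y x : S y -> S x -> toX (vadd y x) = add (toX y) (toX x).
Proof.
  intros Hy Hx; apply sig_eq.
  change (val (toX (vadd y x)) = vadd (val (toX y)) (val (toX x))).
  rewrite !val_toX; trivial; apply HS; trivial.
Qed.

Lemma norm_toX x : S x -> norm (toX x) = nS x.
Proof. intros Hx; change (nS (val (toX x)) = nS x); rewrite val_toX; trivial. Qed.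

Lemma family_continuous p (F : X -> Multi p) x eps :
  continuous_map F -> S x -> 0 < eps ->
  exists delta, 0 < delta /\ forall y, S y -> nS (vsub y x) < delta ->
    forall h, args_in S h p ->
      nT (vsub (family p (F (toX y)) h) (family p (F (toX x)) h)) <= eps * prodn nS h p.
Proof.
  intros HF Hx He; destruct (HF (toX x) eps He) as (d & Hd & H).
  exists d; split; [exact Hd|]; intros y Hy Hyx h Hh.
  specialize (H (toX y)); rewrite toX_sub, norm_toX in H
    by (trivial; apply subspace_sub; trivial); specialize (H Hyx).
  change (norm (sub (ev p (F (toX y)) (fun i => toX (h i))) (ev p (F (toX x)) (fun i => toX (h i))))
          <= eps * prodn nS h p).
  rewrite <- ev_sub, <- prodn_args by exact Hh.
  eapply Rle_trans; [apply ev_bound|].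
  apply Rmult_le_compat_r; [apply prod_norm_pos|exact H].
Qed.

Lemma tower_of_smooth k p (F : X -> Multi p) : smooth k F ->
  exists Dk, (forall x, Dk O x = family p (F (toX x))) /\ tower p k Dk.
Proof.
  revert p F; induction k as [|k IH]; intros p F HF.
  - exists (fun _ x => family p (F (toX x))); split; [reflexivity|].
    split; [|split].
    + intros j x Hj _; replace (p + j)%nat with p by lia; apply family_multilinear.
    + intros; lia.
    + intros j x Hj Hx eps He; replace (p + j)%nat with p by lia.
      apply family_continuous; trivial.
  - pose proof (smooth_continuous _ _ HF) as HF0.
    destruct HF as (F' & HF & HF').
    destruct (IH (Datatypes.S p) F' HF') as (Dk & E & H1 & H2 & H3).
    exists (fun j => match j with O => fun x => family p (F (toX x)) | Datatypes.S i => Dk i end).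
    split; [reflexivity|split; [|split]].
    + intros [|j] x Hj Hx; [rewrite Nat.add_0_r; apply family_multilinear|].
      replace (p + Datatypes.S j)%nat with (Datatypes.S p + j)%nat by lia; apply H1; [lia|exact Hx].
    + intros [|j] x Hj Hx eps He.
      * rewrite Nat.add_0_r; destruct (HF (toX x) eps He) as (d & Hd & H).
        exists d; split; [exact Hd|]; intros v Hv Hvd h Hh.
        specialize (H (toX v)); rewrite norm_toX in H by trivial; specialize (H Hvd).
        rewrite E, toX_add by trivial.
        change (norm (sub (sub (ev p (F (add (toX x) (toX v))) (fun i => toX (h i)))
                               (ev p (F (toX x)) (fun i => toX (h i))))
                          (ev p (lfun (F' (toX x)) (toX v)) (fun i => toX (h i))))
                <= eps * nS v * prodn nS h p).
        rewrite <- !ev_sub, <- prodn_args by exact Hh.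
        eapply Rle_trans; [apply ev_bound|].
        apply Rmult_le_compat_r; [apply prod_norm_pos|exact H].
      * replace (p + Datatypes.S j)%nat with (Datatypes.S p + j)%nat by lia.
        apply H2; trivial; lia.
    + intros [|j] x Hj Hx eps He.
      * rewrite Nat.add_0_r; apply family_continuous; trivial.
      * replace (p + Datatypes.S j)%nat with (Datatypes.S p + j)%nat by lia.
        apply H3; trivial; lia.
Qed.

Lemma Ck_of_smooth k (F : X -> Z) (f : Y -> Y) :
  (forall x, zval (F x) = f (val x)) -> smooth k F -> Ck S nS nT f k.
Proof.
  intros E HF; destruct (tower_of_smooth k O F HF) as (Dk & E0 & H).
  exists Dk; split; [|exact H].
  intros x h Hx; rewrite E0; unfold family; cbn; rewrite E, val_toX; trivial.
Qed.

Lemma hcons_upd (v : Y) h i u : hcons v (upd h i u) = upd (hcons v h) (Datatypes.S i) u.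
Proof. apply functional_extensionality; intros [|k]; reflexivity. Qed.

Lemma upd_hcons (u v : Y) h : upd (hcons u h) O v = hcons v h.
Proof. apply functional_extensionality; intros [|k]; reflexivity. Qed.

Lemma args_in_hcons (v : Y) h p : S v -> args_in S h p -> args_in S (hcons v h) (Datatypes.S p).
Proof. intros Hv Hh [|i] Hi; cbn; [exact Hv|apply Hh; lia]. Qed.

Lemma multilinear_nonneg_bound p M : bounded_multilinear S nS nT p M ->
  exists C, 0 <= C /\ forall h, args_in S h p -> nT (M h) <= C * prodn nS h p.
Proof.
  intros (_ & _ & C & HC); exists (Rmax 0 C); split; [apply Rmax_l|]; intros h Hh.
  eapply Rle_trans; [apply HC, Hh|].
  apply Rmult_le_compat_r; [apply prodn_pos, Hh|apply Rmax_r].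
Qed.

Lemma multilinear_hcons p M v : S v ->
  bounded_multilinear S nS nT (Datatypes.S p) M ->
  bounded_multilinear S nS nT p (fun h => M (hcons v h)).
Proof.
  intros Hv HM; destruct (multilinear_nonneg_bound _ _ HM) as (C & HC & HCb).
  destruct HM as (He & Hl & _); split; [|split].
  - intros h h' H; apply He; intros [|i] Hi; cbn; [reflexivity|apply H; lia].
  - intros h i a u w Hi Hh Hu Hw; rewrite !hcons_upd.
    apply Hl; trivial; [lia|apply args_in_hcons; trivial].
  - exists (C * nS v); intros h Hh.
    pose proof (HCb _ (args_in_hcons v h p Hv Hh)) as B.
    rewrite prodn_shift in B; rewrite Rmult_assoc; exact B.
Qed.

Lemma multilinear_first p M h a u v : S u -> S v -> args_in S h p ->
  bounded_multilinear S nS nT (Datatypes.S p) M ->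
  M (hcons (vadd (vscal a u) v) h) = vadd (vscal a (M (hcons u h))) (M (hcons v h)).
Proof.
  intros Hu Hv Hh (_ & Hl & _).
  pose proof (Hl (hcons u h) O a u v ltac:(lia) (args_in_hcons u h p Hu Hh) Hu Hv) as E.
  rewrite !upd_hcons in E; exact E.
Qed.

(** [bounded_multilinear] does not place the values of [M] in [T]; taking [T] to be everything makes
    them elements of the target space. *)
Lemma curry_ex p M : (forall y, T y) -> bounded_multilinear S nS nT p M ->
  exists w : Multi p, forall h, zval (ev p w h) = M (fun i => val (h i)).
Proof.
  intros HTall; revert M; induction p as [|p IH]; intros M HM.
  - exists (exist T (M (fun _ => vzero)) (HTall _)); intros h; cbn.
    apply HM; intros i Hi; lia.
  - pose proof (fun x : X => IH _ (multilinear_hcons p M (val x) (val_in x) HM)) as Hex.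
    pose (l x := proj1_sig (constructive_indefinite_description _ (Hex x))).
    assert (Hl : forall x h, zval (ev p (l x) h) = M (hcons (val x) (fun i => val (h i))))
      by (intros x; apply (proj2_sig (constructive_indefinite_description _ (Hex x)))).
    clearbody l.
    assert (Hargs : forall (h : nat -> X) q, args_in S (fun i => val (h i)) q)
      by (intros h q i _; apply val_in).
    (* Although [l] comes from choice, it is linear: by [ev_inj] its values are determined by their
       evaluations, which are linear in the first slot. *)
    assert (Hlin : forall a u v, l (add (scal a u) v) = add (scal a (l u)) (l v)).
    { intros a u v; apply ev_inj; intros h; apply sig_eq.
      rewrite ev_add, ev_scal.
      change (zval (ev p (l (add (scal a u) v)) h) =
              vadd (vscal a (zval (ev p (l u) h))) (zval (ev p (l v) h))).
      rewrite !Hl; apply (multilinear_first p M); trivial; apply val_in. }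
    assert (Hadd : forall u v, l (add u v) = add (l u) (l v)).
    { intros u v; replace (add u v) with (add (scal 1 u) v) by nvec.
      rewrite Hlin; nvec. }
    assert (Hzero : l zero = zero).
    { replace (zero : X) with (add (scal (-1) (zero : X)) zero) by nvec.
      rewrite Hlin; nvec. }
    destruct (multilinear_nonneg_bound _ _ HM) as (C & HC & HCb).
    assert (Hscal : forall a x, l (scal a x) = scal a (l x)).
    { intros a x; replace (scal a x) with (add (scal a x) zero) by nvec.
      rewrite Hlin, Hzero; nvec. }
    assert (Hbound : forall x, norm (l x) <= C * norm x).
    { intros x; apply ev_norm_le; [apply Rmult_le_pos; [exact HC|apply norm_pos]|]; intros h.
      change (nT (zval (ev p (l x) h)) <= C * norm x * prod_norm h p); rewrite Hl.
      eapply Rle_trans; [apply HCb, args_in_hcons; [apply val_in|apply Hargs]|].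
      rewrite prodn_shift, prod_norm_prodn, Rmult_assoc; apply Rle_refl. }
    exists (@mkLin X (Multi p) l Hadd Hscal C HC Hbound).
    intros h; cbn; rewrite Hl.
    apply HM; intros [|i] _; reflexivity.
Qed.

Lemma curry_family_ex p (M : Y -> (nat -> Y) -> Y) : (forall y, T y) ->
  (forall x, S x -> bounded_multilinear S nS nT p (M x)) ->
  exists F : X -> Multi p, forall x h, zval (ev p (F x) h) = M (val x) (fun i => val (h i)).
Proof.
  intros HTall HM.
  pose (Hex (x : X) := curry_ex p (M (val x)) HTall (HM (val x) (val_in x))).
  exists (fun x => proj1_sig (constructive_indefinite_description _ (Hex x))).
  intros x; apply (proj2_sig (constructive_indefinite_description _ (Hex x))).
Qed.

Lemma family_norm_le p (w : Multi p) (M : (nat -> Y) -> Y) C : 0 <= C ->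
  (forall h, zval (ev p w h) = M (fun i => val (h i))) ->
  (forall h, args_in S h p -> nT (M h) <= C * prodn nS h p) -> norm w <= C.
Proof.
  intros HC E HM; apply ev_norm_le; [exact HC|]; intros h.
  change (nT (zval (ev p w h)) <= C * prod_norm h p); rewrite E, prod_norm_prodn.
  apply HM; intros i _; apply val_in.
Qed.

Lemma smooth_of_tower k p Dk : (forall y, T y) -> tower p k Dk ->
  exists F : X -> Multi p,
    (forall x h, zval (ev p (F x) h) = Dk O (val x) (fun i => val (h i))) /\ smooth k F.
Proof.
  intros HTall; revert p Dk; induction k as [|k IH]; intros p Dk (H1 & H2 & H3).
  - destruct (curry_family_ex p (Dk O) HTall) as [F HF].
    { intros x Hx; pose proof (H1 O x ltac:(lia) Hx) as B; rewrite Nat.add_0_r in B; exact B. }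
    exists F; split; [exact HF|]; intros x eps He.
    destruct (H3 O (val x) ltac:(lia) (val_in x) eps He) as (d & Hd & H).
    rewrite Nat.add_0_r in H.
    exists d; split; [exact Hd|]; intros y Hy.
    apply family_norm_le with (fun h => vsub (Dk O (val y) h) (Dk O (val x) h)); [lra| |].
    + intros h; rewrite ev_sub, <- !HF; reflexivity.
    + intros h Hh; apply H; trivial; apply val_in.
  - destruct (curry_family_ex p (Dk O) HTall) as [F HF].
    { intros x Hx; pose proof (H1 O x ltac:(lia) Hx) as B; rewrite Nat.add_0_r in B; exact B. }
    destruct (IH (Datatypes.S p) (fun j => Dk (Datatypes.S j))) as (F' & HF' & Hs).
    { split; [|split].
      - intros j x Hj Hx; replace (Datatypes.S p + j)%nat with (p + Datatypes.S j)%nat by lia.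
        apply H1; trivial; lia.
      - intros j x Hj Hx; replace (Datatypes.S p + j)%nat with (p + Datatypes.S j)%nat by lia.
        apply H2; trivial; lia.
      - intros j x Hj Hx; replace (Datatypes.S p + j)%nat with (p + Datatypes.S j)%nat by lia.
        apply H3; trivial; lia. }
    exists F; split; [exact HF|]; exists F'; split; [|exact Hs].
    intros x eps He.
    destruct (H2 O (val x) ltac:(lia) (val_in x) eps He) as (d & Hd & H).
    rewrite Nat.add_0_r in H.
    exists d; split; [exact Hd|]; intros v Hv.
    apply family_norm_le with (fun h => vsub (vsub (Dk O (vadd (val x) (val v)) h) (Dk O (val x) h))
                                             (Dk 1%nat (val x) (hcons (val v) h))).
    + apply Rmult_le_pos; [lra|apply norm_pos].
    + intros h; rewrite !ev_sub.
      change (ev p (lfun (F' x) v) h) with (ev (Datatypes.S p) (F' x) (ncons v h)).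
      change (vsub (vsub (zval (ev p (F (add x v)) h)) (zval (ev p (F x) h)))
                   (zval (ev (Datatypes.S p) (F' x) (ncons v h))) =
              vsub (vsub (Dk O (val (add x v)) (fun i => val (h i))) (Dk O (val x) (fun i => val (h i))))
                (Dk 1%nat (val x) (hcons (val v) (fun i => val (h i))))).
      rewrite !HF, HF'; do 2 f_equal.
      apply functional_extensionality; intros [|i]; reflexivity.
    + intros h Hh; apply (H (val v) (val_in v) Hv h Hh).
Qed.

Lemma smooth_of_Ck k (f : Y -> Y) : (forall y, T y) -> Ck S nS nT f k ->
  exists F : X -> Z, (forall x, zval (F x) = f (val x)) /\ smooth k F.
Proof.
  intros HTall (Dk & E & H).
  destruct (smooth_of_tower k O Dk HTall H) as (F & HF & Hs).
  exists F; split; [|exact Hs]; intros x.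
  exact (eq_trans (HF x (fun _ => zero)) (E _ _ (val_in x))).
Qed.

End Towers.

Lemma seminorm_hnorm {Y : RHilbert} (S : Y -> Prop) : seminorm_on S hnorm.
Proof.
  split; [|split]; intros; [apply hnorm_pos|apply hnorm_triang|rewrite hnorm_scal; lra].
Qed.

Lemma seminorm_graph {Y : RHilbert} (S : Y -> Prop) (L : Y -> Y) :
  linear_on S L -> seminorm_on S (graph_norm L).
Proof.
  intros [La Ls]; unfold graph_norm; split; [|split].
  - intros x _; pose proof (hnorm_pos _ x); pose proof (hnorm_pos _ (L x)); lra.
  - intros x y Hx Hy; rewrite La by trivial.
    pose proof (hnorm_triang _ x y); pose proof (hnorm_triang _ (L x) (L y)); lra.
  - intros a x Hx; rewrite Ls by trivial; rewrite !hnorm_scal; lra.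
Qed.

Lemma subspace_full {Y : RHilbert} : subspace (fun _ : Y => True).
Proof. repeat split. Qed.

(** * The maps [PF_t] between [H_X] and [H_Y] *)

Section Restriction.
Variable Y : RHilbert.
Variable D : Y -> Prop.
Variable L : Y -> Y.
Variables (lam : R) (phi : Y).
Hypothesis HL : self_adjoint D L.
Hypothesis Heig : simple_isolated_eigen D L lam phi.

Definition domain_space : SNSpace :=
  sub_space D (graph_norm L) (proj1 HL) (seminorm_graph D L (proj1 (proj2 (proj2 HL)))).

Definition full_space : SNSpace :=
  sub_space (fun _ : Y => True) hnorm subspace_full (seminorm_hnorm _).

Definition HX_space : SNSpace :=
  sub_space (HX D phi) (graph_norm L) (subspace_HX Y D L phi HL)
    (seminorm_graph _ L (linear_on_HX Y D L phi HL)).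

Definition HY_space : SNSpace :=
  sub_space (HY phi) hnorm (subspace_HY Y phi) (seminorm_hnorm _).

Definition inclusion : Lin HX_space domain_space.
Proof.
  refine (@mkLin HX_space domain_space
    (fun x => exist D (proj1_sig x) (proj1 (proj2_sig x))) _ _ 1 Rle_0_1 _).
  - intros x y; apply sig_eq; reflexivity.
  - intros a x; apply sig_eq; reflexivity.
  - intros x; cbn; lra.
Defined.

Definition projection : Lin full_space HY_space.
Proof.
  refine (@mkLin full_space HY_space
    (fun y => exist (HY phi) (Pproj phi (proj1_sig y)) (Pproj_HY Y D L lam phi Heig _))
    _ _ 1 Rle_0_1 _).
  - intros x y; apply sig_eq; cbn; unfold Pproj; rewrite inner_add; hvec.
  - intros a x; apply sig_eq; cbn; unfold Pproj; rewrite inner_scal; hvec.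
  - intros x; cbn; rewrite Rmult_1_l; apply (hnorm_Pproj Y D L lam phi Heig).
Defined.

Definition PF_restricted (N : Y -> Y) (t : R) (x : HX_space) : HY_space :=
  exist (HY phi) (PF L N phi t (proj1_sig x)) (Pproj_HY Y D L lam phi Heig _).

(** [PF_t] is the projection after [F] after an affine inclusion. Smoothness is extracted for [F]
    into all of [Y], where [curry_ex] applies, and only then projected to [H_Y]. *)
Lemma smooth_PF N k t : Ck D (graph_norm L) hnorm (fun x => vsub (L x) (N x)) k ->
  smooth k (PF_restricted N t).
Proof.
  intros HF.
  destruct (smooth_of_Ck Y D (fun _ => True) (graph_norm L) hnorm (proj1 HL) subspace_full
     (seminorm_graph D L (proj1 (proj2 (proj2 HL)))) (seminorm_hnorm _) k _ (fun _ => I) HF)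
    as (F & EF & HFs).
  pose (c := exist D (vscal t phi) (proj2 (proj2 (proj1 HL)) t phi (proj1 Heig)) : domain_space).
  apply smooth_ext with (fun x => projection (F (add (inclusion x) c))).
  - intros x; apply sig_eq.
    change (Pproj phi (zval _ _ _ subspace_full (seminorm_hnorm _) (F (add (inclusion x) c)))
            = PF L N phi t (proj1_sig x)).
    rewrite EF; reflexivity.
  - apply smooth_post, (smooth_comp k F); [exact HFs|apply smooth_affine].
Qed.

Section Perturbation.
Variables (N : Y -> Y) (n m : R).
Hypothesis Hn : 0 <= n < m.
Hypothesis HLip : forall t w1 w2, HY phi w1 -> HY phi w2 ->
  hnorm (vsub (Pproj phi (N (vadd w1 (vscal t phi)))) (Pproj phi (N (vadd w2 (vscal t phi)))))
    <= n * hnorm (vsub w1 w2).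
Hypothesis Honto : onto (HX D phi) (HY phi) L.
Hypothesis Hbb : bounded_below (HX D phi) L m.

Lemma perturbation_bilip (G : Y -> Y) :
  (forall x, HX D phi x -> HY phi (G x)) ->
  (forall x y, HX D phi x -> HX D phi y -> hnorm (vsub (G x) (G y)) <= n * hnorm (vsub x y)) ->
  exists g, bilip_homeo_with (HX D phi) (HY phi) (graph_norm L) hnorm
    (fun x => vsub (L x) (G x)) g (1 + n) ((1 + n) / (m - n) + 1).
Proof.
  intros HGT HG.
  apply perturbed_bilip; eauto using subspace_HX, subspace_HY, linear_on_HX, L_HX_HY.
  intros u x z Hu Hx Hz.
  destruct (closed_on_HX Y D L phi HL 0 u x z Hu Hx) as [H1 H2].
  - intros eps He; destruct (Hz eps He) as [K HK]; exists K; intros k Hk.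
    replace (shift L 0 (u k)) with (L (u k)) by (unfold shift; hvec); auto.
  - split; [exact H1|]; rewrite <- H2; unfold shift; hvec.
Qed.

Lemma PF_bilip t : exists g,
  bilip_homeo_with (HX D phi) (HY phi) (graph_norm L) hnorm (PF L N phi t) g
    (1 + n) ((1 + n) / (m - n) + 1).
Proof.
  destruct (perturbation_bilip (fun w => Pproj phi (N (vadd w (vscal t phi)))))
    as (g & H1 & H2 & H3 & H4 & H5 & H6).
  - intros x _; apply (Pproj_HY Y D L lam phi Heig).
  - intros x y Hx Hy; apply HLip; [apply Hx|apply Hy].
  - exists g.
    pose proof (PF_HX Y D L lam phi HL Heig N t) as E.
    split; [intros x Hx; rewrite E by trivial; auto|].
    split; [exact H2|].
    split; [intros x Hx; rewrite E by trivial; auto|].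
    split; [intros y Hy; rewrite E by auto; auto|].
    split; [intros x y Hx Hy; rewrite !E by trivial; auto|exact H6].
Qed.

Lemma PF_derivative_close t (x : HX_space) (l : Lin HX_space HY_space) (v : HX_space) :
  has_derivative (PF_restricted N t) x l ->
  hnorm (vsub (L (proj1_sig v)) (proj1_sig (l v))) <= n * hnorm (proj1_sig v).
Proof.
  intros Hd; apply le_epsilon; intros eps He.
  pose proof (norm_pos _ v) as Pv.
  destruct (Hd (eps / (norm v + 1))) as (d & Hd0 & H); [apply Rdiv_lt_0_compat; lra|].
  set (s := d / (2 * (norm v + 1))).
  assert (Hs : 0 < s) by (apply Rdiv_lt_0_compat; lra).
  assert (Hsv : norm (scal s v) <= s * norm v)
    by (eapply Rle_trans; [apply norm_scal|]; rewrite Rabs_right by lra; lra).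
  assert (Hsd : s * (norm v + 1) < d) by (unfold s; apply Rle_lt_trans with (d / 2); [right; field; lra|lra]).
  specialize (H (scal s v) ltac:(nra)).
  set (xv := proj1_sig x) in *; set (vv := proj1_sig v) in *.
  set (G w := Pproj phi (N (vadd w (vscal t phi)))).
  pose proof (proj2_sig x) as Sx; pose proof (proj2_sig v) as Sv.
  cbn beta in Sx, Sv; fold xv in Sx; fold vv in Sv.
  pose proof (subspace_HX Y D L phi HL) as (_ & Sadd & Sscal).
  assert (Ssv : HX D phi (vscal s vv)) by (apply Sscal, Sv).
  assert (Sxv : HX D phi (vadd xv (vscal s vv))) by (apply Sadd; trivial).
  change (hnorm (vsub (vsub (PF L N phi t (vadd xv (vscal s vv))) (PF L N phi t xv))
            (proj1_sig (l (scal s v)))) <= eps / (norm v + 1) * norm (scal s v)) in H.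
  rewrite lin_scal in H.
  change (proj1_sig (scal s (l v))) with (vscal s (proj1_sig (l v))) in H.
  rewrite !(PF_HX Y D L lam phi HL Heig) in H by trivial.
  destruct (linear_on_HX Y D L phi HL) as [La Ls].
  rewrite La, Ls in H by trivial.
  fold (G xv) in H; fold (G (vadd xv (vscal s vv))) in H.
  pose proof (HLip t (vadd xv (vscal s vv)) xv (proj2 Sxv) (proj2 Sx)) as HG.
  fold (G xv) in HG; fold (G (vadd xv (vscal s vv))) in HG.
  replace (vsub (vadd xv (vscal s vv)) xv) with (vscal s vv) in HG by hvec.
  rewrite hnorm_scal, Rabs_right in HG by lra.
  set (dG := vsub (G (vadd xv (vscal s vv))) (G xv)) in *.
  apply Rmult_le_reg_l with s; [exact Hs|].
  rewrite <- (Rabs_right s) at 1 by lra; rewrite <- hnorm_scal.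
  set (r := vsub _ _) in H at 1.
  replace (vscal s (vsub (L vv) (proj1_sig (l v)))) with (vadd r dG)
    by (unfold r, dG; hvec).
  eapply Rle_trans; [apply hnorm_triang|].
  assert (E : eps = eps / (norm v + 1) * (norm v + 1)) by (field; lra).
  assert (Hq : 0 < eps / (norm v + 1)) by (apply Rdiv_lt_0_compat; lra).
  set (q := eps / (norm v + 1)) in *.
  assert (q * norm (scal s v) <= q * (s * norm v)) by (apply Rmult_le_compat_l; lra).
  assert (0 < s * q) by nra.
  replace (s * (n * hnorm vv + eps)) with (n * (s * hnorm vv) + s * q * norm v + s * q)
    by (rewrite E; ring).
  lra.
Qed.

Lemma PF_derivative_inverse t (x : HX_space) (l : Lin HX_space HY_space) :
  has_derivative (PF_restricted N t) x l ->
  exists J : Lin HY_space HX_space, onorm J <= (1 + n) / (m - n) + 1 /\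
    (forall z, l (J z) = z) /\ (forall v, J (l v) = v).
Proof.
  intros Hd.
  pose (toHX := toX Y (HX D phi) (graph_norm L) (subspace_HX Y D L phi HL)
                  (seminorm_graph _ L (linear_on_HX Y D L phi HL))).
  assert (EX : forall w (Hw : HX D phi w), toHX w = exist (HX D phi) w Hw)
    by (intros w Hw; apply sig_eq; apply (val_toX Y (HX D phi)); exact Hw).
  destruct (perturbation_bilip (fun w => vsub (L w) (proj1_sig (l (toHX w)))))
    as (g & H1 & H2 & H3 & H4 & _ & H6).
  - intros w Hw; apply subspace_sub; [apply subspace_HY| |apply proj2_sig].
    exact (L_HX_HY Y D L lam phi HL Heig w Hw).
  - intros w1 w2 Hw1 Hw2.
    pose proof (PF_derivative_close t x l (sub (toHX w1) (toHX w2)) Hd) as B.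
    rewrite lin_sub in B; rewrite !(EX _ Hw1), !(EX _ Hw2) in *.
    change (hnorm (vsub (L (vsub w1 w2)) (vsub (proj1_sig (l (exist (HX D phi) w1 Hw1)))
              (proj1_sig (l (exist (HX D phi) w2 Hw2))))) <= n * hnorm (vsub w1 w2)) in B.
    rewrite (linear_on_sub Y (HX D phi) L w1 w2 (subspace_HX Y D L phi HL)
               (linear_on_HX Y D L phi HL) Hw1 Hw2) in B.
    eapply Rle_trans; [|exact B]; right; f_equal; hvec.
  - assert (El : forall w, vsub (L w) (vsub (L w) (proj1_sig (l (toHX w)))) = proj1_sig (l (toHX w)))
      by (intros; hvec).
    set (c2 := (1 + n) / (m - n) + 1) in *.
    assert (Hc2 : 0 <= c2).
    { unfold c2; assert (0 <= (1 + n) / (m - n)); [|lra].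
      apply Rmult_le_pos; [lra|left; apply Rinv_0_lt_compat; lra]. }
    pose (J (z : HY_space) := exist (HX D phi) (g (proj1_sig z)) (H2 _ (proj2_sig z)) : HX_space).
    assert (HlJ : forall z, l (J z) = z).
    { intros z; apply sig_eq; pose proof (H4 _ (proj2_sig z)) as E.
      rewrite El, (EX _ (H2 _ (proj2_sig z))) in E; exact E. }
    assert (HJl : forall v, J (l v) = v).
    { intros v; apply sig_eq.
      pose proof (H3 _ (proj2_sig v)) as E; rewrite El, (EX _ (proj2_sig v)) in E.
      replace (exist (HX D phi) (proj1_sig v) (proj2_sig v) : HX_space) with v in E
        by (apply sig_eq; reflexivity).
      exact E. }
    assert (Hinj : forall u v, l u = l v -> u = v).
    { intros u v E; rewrite <- (HJl u), <- (HJl v), E; reflexivity. }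
    assert (Hadd : forall y z, J (add y z) = add (J y) (J z)).
    { intros y z; apply Hinj; rewrite lin_add, !HlJ; reflexivity. }
    assert (Hscal : forall a z, J (scal a z) = scal a (J z)).
    { intros a z; apply Hinj; rewrite lin_scal, !HlJ; reflexivity. }
    assert (Hbound : forall z, norm (J z) <= c2 * norm z).
    { intros z; pose proof (H6 _ _ (proj2_sig z) (proj1 (subspace_HY Y phi))) as B.
      assert (E0 : J zero = zero) by (rewrite <- (scal_0 _ zero), Hscal; apply scal_0).
      assert (E0' : g vzero = vzero) by exact (f_equal (@proj1_sig _ _) E0).
      rewrite E0' in B.
      replace (vsub (proj1_sig z) vzero) with (proj1_sig z) in B by hvec.
      replace (vsub (g (proj1_sig z)) vzero) with (g (proj1_sig z)) in B by hvec.
      exact B. }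
    exists (mkLin J Hadd Hscal c2 Hc2 Hbound); split; [|split; [exact HlJ|exact HJl]].
    apply onorm_le; [exact Hc2|exact Hbound].
Qed.

Lemma PF_diffeo k t : (1 <= k)%nat ->
  Ck D (graph_norm L) hnorm (fun x => vsub (L x) (N x)) k ->
  Ck_diffeo (HX D phi) (HY phi) (graph_norm L) hnorm (PF L N phi t) k.
Proof.
  intros Hk HF; destruct k as [|k]; [lia|].
  pose proof (smooth_PF N (Datatypes.S k) t HF) as Hs.
  destruct (PF_bilip t) as (g & H1 & H2 & H3 & H4 & _ & H6).
  split; [exact H1|].
  exists g; split; [exact H2|split; [exact H3|split; [exact H4|split]]].
  - apply (Ck_of_smooth Y (HX D phi) (HY phi) _ _ (subspace_HX Y D L phi HL) (subspace_HY Y phi)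
      (seminorm_graph _ L (linear_on_HX Y D L phi HL)) (seminorm_hnorm _) _
      (PF_restricted N t)); [reflexivity|exact Hs].
  - destruct Hs as (f' & Hf & Hf').
    pose (gr (z : HY_space) := exist (HX D phi) (g (proj1_sig z)) (H2 _ (proj2_sig z)) : HX_space).
    pose (Hex z := PF_derivative_inverse t (gr z) (f' (gr z)) (Hf (gr z))).
    pose (J z := proj1_sig (constructive_indefinite_description _ (Hex z))).
    assert (HJ : forall z, onorm (J z) <= (1 + n) / (m - n) + 1 /\
        (forall y, f' (gr z) (J z y) = y) /\ (forall v, J z (f' (gr z) v) = v))
      by (intros z; apply (proj2_sig (constructive_indefinite_description _ (Hex z)))).
    clearbody J; clear Hex.
    apply (Ck_of_smooth Y (HY phi) (HX D phi) _ _ (subspace_HY Y phi) (subspace_HX Y D L phi HL)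
      (seminorm_hnorm _) (seminorm_graph _ L (linear_on_HX Y D L phi HL)) _ gr); [reflexivity|].
    apply (smooth_inverse_function HX_space HY_space (PF_restricted N t) f' gr J
             ((1 + n) / (m - n) + 1)); trivial.
    + intros z; apply sig_eq; apply H4, proj2_sig.
    + intros y z; apply H6; apply proj2_sig.
    + intros z; apply HJ.
    + intros u; apply HJ.
    + intros u; apply HJ.
Qed.

End Perturbation.
End Restriction.

Theorem theorem3 (Y : RHilbert) (D : Y -> Prop) (L N : Y -> Y)
  (lam_p : R) (phi_p : Y) (n : R)
  (HL : self_adjoint D L)
  (Heig : simple_isolated_eigen D L lam_p phi_p)
  (Hn : 0 <= n)
  (HLip : forall t w1 w2, HY phi_p w1 -> HY phi_p w2 ->
     hnorm (vsub (Pproj phi_p (N (vadd w1 (vscal t phi_p))))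
                 (Pproj phi_p (N (vadd w2 (vscal t phi_p)))))
       <= n * hnorm (vsub w1 w2))
  (Hspec : forall mu, -n <= mu <= n -> (in_spectrum D L mu <-> mu = lam_p)) :
  (exists c1 c2 : R, forall t : R, exists g : Y -> Y,
     bilip_homeo_with (HX D phi_p) (HY phi_p) (graph_norm L) hnorm
       (PF L N phi_p t) g c1 c2) /\
  (forall k : nat, (1 <= k)%nat ->
     Ck D (graph_norm L) hnorm (fun x => vsub (L x) (N x)) k ->
     forall t : R,
       Ck_diffeo (HX D phi_p) (HY phi_p) (graph_norm L) hnorm (PF L N phi_p t) k).
Proof.
  destruct (spectral_gap Y D L lam_p phi_p HL Heig n Hn Hspec) as (Honto & m & Hm & Hbb).
  split.
  - exists (1 + n), ((1 + n) / (m - n) + 1); intros t.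
    apply (PF_bilip Y D L lam_p phi_p HL Heig N n m); trivial; lra.
  - intros k Hk HF t.
    apply (PF_diffeo Y D L lam_p phi_p HL Heig N n m); trivial; lra.
Qed.
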